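(* Let $\Gamma$ be a finitely generated group that admits a decreasing chain of subgroups $$\Gamma=\Gamma_0\supsetneq \Gamma_1 \supsetneq \Gamma_2\supsetneq \dots$$ where each $\Gamma_k$ is a finite-index normal subgroup of $\Gamma$ with $\Gamma_k\cong\Gamma$. Set $\Gamma_\infty:=\bigcap_k \Gamma_k$. Then $\Gamma/\Gamma_\infty$ is nilpotent and, modulo torsion, it is free abelian, i.e. the quotient of $\Gamma/\Gamma_\infty$ by its torsion subgroup is a free abelian group.
   Context: For a finitely generated nilpotent group $N$, the set $\operatorname{Tor}(N)$ of torsion elements is a finite normal subgroup, called the torsion subgroup; ''$N$ modulo torsion'' means $N/\operatorname{Tor}(N)$. The isomorphisms $\Gamma_k\cong\Gamma$ are isomorphisms of abstract groups. *)

(* Defs.v *)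
From HB Require Import structures.
From mathcomp Require Import all_boot ssralg ssrint.
From mathcomp Require Import boolp classical_sets cardinality.
From mathcomp Require Import freeg.

Set Implicit Arguments.
Unset Strict Implicit.
Unset Printing Implicit Defensive.

Local Open Scope classical_set_scope.
Local Open Scope group_scope.
Local Open Scope quotient_scope.

Definition is_subgroup (G : groupType) (H : set G) : Prop :=
  [/\ H 1, forall x y, H x -> H y -> H (x * y) & forall x, H x -> H x^-1].

Record subgroup (G : groupType) := Subgroup {
  subgroup_set :> set G;
  subgroupP : is_subgroup subgroup_set
}.

Definition normal (G : groupType) (H : subgroup G) : Prop :=
  forall x y : G, subgroup_set H x -> subgroup_set H (x ^ y).

Definition finite_index (G : groupType) (H : subgroup G) : Prop :=
  finite_set (range (fun g : G => [set g * h | h in subgroup_set H])).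

Definition generated (G : groupType) (S : set G) : set G :=
  smallest (@is_subgroup G) S.

Definition finitely_generated (G : groupType) : Prop :=
  exists S : set G, finite_set S /\ generated S = [set: G].

Definition lower_central (G : groupType) : nat -> set G :=
  fix lower n :=
    if n is m.+1 then generated [set [~ x, y] | x in lower m & y in [set: G]]
    else [set: G].

Arguments lower_central : clear implicits.

Definition nilpotent (G : groupType) : Prop :=
  exists n, lower_central G n = [set 1].

Definition torsion (G : groupType) : set G :=
  [set x | exists n, (0 < n)%N /\ x ^+ n = 1].

Arguments torsion : clear implicits.

Definition isomorphic (G H : groupType) : Prop :=
  exists f : {multiplicative G -> H}, bijective f.

Definition free_abelian (G : groupType) : Prop :=
  exists K : choiceType, isomorphic G (Algebra.to_multiplicative {freeg K / int}).

Section SubgroupType.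
Variables (G : groupType) (H : subgroup G).

Definition subgroup_type : Type := {x : G | x \in subgroup_set H}.

Fact subgroup_group_closed : group_closed (mem (subgroup_set H)).
Proof.
have [H1 HM HV] := subgroupP H.
split; first exact/mem_set.
by move=> x y /set_mem Hx /set_mem Hy; apply/mem_set/HM => //; exact: HV.
Qed.

HB.instance Definition _ := SubChoice.on subgroup_type.
HB.instance Definition _ :=
  SubChoice_isSubGroup.Build G _ subgroup_type subgroup_group_closed.

End SubgroupType.

Section Quotient.
Variables (G : groupType) (H : subgroup G).

Definition coset_rel : rel G := fun x y => `[< subgroup_set H (x^-1 * y) >].

Fact coset_rel_refl : reflexive coset_rel.
Proof. by move=> x; apply/asboolP; rewrite mulVg; case: (subgroupP H). Qed.

Fact coset_rel_sym : symmetric coset_rel.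
Proof.
have [_ _ HV] := subgroupP H.
by move=> x y; apply: asbool_equiv_eq; split=> /HV; rewrite invgM invgK.
Qed.

Fact coset_rel_trans : transitive coset_rel.
Proof.
have [_ HM _] := subgroupP H.
move=> y x z /asboolP Hxy /asboolP Hyz; apply/asboolP.
by have := HM _ _ Hxy Hyz; rewrite -mulgA mulVKg.
Qed.

Canonical coset_equiv :=
  EquivRel coset_rel coset_rel_refl coset_rel_sym coset_rel_trans.

(* The normality proof is a phantom argument: only the group structure declared
   on the quotient below needs it. *)
Definition quotient (nH : normal H) : Type := {eq_quot coset_rel}.

Variable nH : normal H.
Local Notation Q := (quotient nH).

HB.instance Definition _ := Choice.on Q.
HB.instance Definition _ := EqQuotient.on Q.

Definition quotient_one : Q := \pi_Q 1.
Definition quotient_mul (u v : Q) : Q := \pi_Q (repr u * repr v).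
Definition quotient_inv (u : Q) : Q := \pi_Q (repr u)^-1.

Fact quotient_piP (x y : G) : subgroup_set H (x^-1 * y) <-> \pi_Q x = \pi_Q y.
Proof.
by split=> [Hxy|/eqquotP/asboolP//]; exact/eqquotP/asboolP.
Qed.

Fact quotient_piM (x y : G) :
  quotient_mul (\pi_Q x) (\pi_Q y) = \pi_Q (x * y).
Proof.
have [_ HM _] := subgroupP H.
have /quotient_piP Hx : \pi_Q (repr (\pi_Q x)) = \pi_Q x by rewrite reprK.
have /quotient_piP Hy : \pi_Q (repr (\pi_Q y)) = \pi_Q y by rewrite reprK.
apply/quotient_piP; have := HM _ _ (nH (repr (\pi_Q y)) Hx) Hy.
by rewrite /conjg invgM !mulgA mulgK.
Qed.

Fact quotient_piV (x : G) : quotient_inv (\pi_Q x) = \pi_Q x^-1.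
Proof.
have [_ _ HV] := subgroupP H.
have /quotient_piP Hx : \pi_Q (repr (\pi_Q x)) = \pi_Q x by rewrite reprK.
apply/quotient_piP; have := HV _ (nH x^-1 Hx).
by rewrite /conjg invgK -!mulgA mulgV mulg1 invgM.
Qed.

Fact quotient_mulA : associative quotient_mul.
Proof.
elim/quotW=> x; elim/quotW=> y; elim/quotW=> z.
rewrite (quotient_piM y z) (quotient_piM x y).
by rewrite (quotient_piM x (y * z)) (quotient_piM (x * y) z) mulgA.
Qed.

Fact quotient_mul1g : left_id quotient_one quotient_mul.
Proof. by elim/quotW=> x; rewrite quotient_piM mul1g. Qed.

Fact quotient_mulg1 : right_id quotient_one quotient_mul.
Proof. by elim/quotW=> x; rewrite quotient_piM mulg1. Qed.

Fact quotient_mulVg : left_inverse quotient_one quotient_inv quotient_mul.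
Proof. by elim/quotW=> x; rewrite quotient_piV quotient_piM mulVg. Qed.

Fact quotient_mulgV : right_inverse quotient_one quotient_inv quotient_mul.
Proof. by elim/quotW=> x; rewrite quotient_piV quotient_piM mulgV. Qed.

HB.instance Definition _ := isGroup.Build Q
  quotient_mulA quotient_mul1g quotient_mulg1 quotient_mulVg quotient_mulgV.

End Quotient.

Section Intersection.
Variables (G : groupType) (H : nat -> subgroup G).

Fact bigcap_is_subgroup : is_subgroup (\bigcap_k (H k : set G)).
Proof.
split=> [k _|x y Hx Hy k _|x Hx k _]; have [H1 HM HV] := subgroupP (H k) => //.
  by apply: HM; [exact: Hx|exact: Hy].
by apply: HV; exact: Hx.
Qed.

Definition bigcap_subgroup : subgroup G := Subgroup bigcap_is_subgroup.

Fact bigcap_normal : (forall k, normal (H k)) -> normal bigcap_subgroup.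
Proof. by move=> nH x y Hx k _; apply: nH; exact: Hx. Qed.

End Intersection.

(* Main.v *)
From HB Require Import structures.
Require Import Defs.
From mathcomp Require Import all_boot.
From mathcomp Require Import classical_sets.
From mathcomp Require Import ssralg ssrint matrix intdiv boolp cardinality freeg.
From mathcomp Require Import ssrnum order zmodp.

Set Implicit Arguments.
Unset Strict Implicit.
Unset Printing Implicit Defensive.

Local Open Scope classical_set_scope.
Local Open Scope group_scope.

(** The isomorphisms turn the chain into a sequence of injective endomorphisms
    [f k] of [G] whose ranges are normal, of finite index and decreasing.

    The quotients of [G] by the ranges are nilpotent
    ([normal_embedding_nilpotent]); here a single embedding [f] suffices.  On
    finite quotients of [G] that [f] respects, the kernel of [f] has no more
    elements than [G / range f], so a subgroup of [G] of bounded index acts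
    trivially on it and on the kernels that arise from it by iteration.  Some
    fixed iterate of [f] maps the part of the quotient on which [f] is nilpotent
    into that subgroup, whence a nilpotent action of this part on itself; and
    this part maps onto [G / range f].

    It remains to see that, up to finite groups, the commutators of the range
    of [f k] with [G] disappear in the limit.  The embeddings induce
    endomorphisms of the finitely generated abelianization of [G] with finite
    cokernel, hence with torsion kernel ([embedding_tors]).  Therefore [G] acts
    on the abelianization of [range (f k)] trivially up to torsion; as that group
    is the same for all [k] up to isomorphism, a subgroup of finite index acts
    trivially on it for all [k] at once ([chain_ab_central]).  One step further, an element of that
    subgroup acts on [range (f k)] modulo the second term of its lower central
    series by a homomorphism from the abelianization to the first factor of that
    series.  The finitely generated abelian group of all such homomorphisms
    does not depend on [k] either, and a power of the element acts as an inner
    automorphism; so a power with exponent independent of [k] does.  Hence there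
    is [m] such that the first factor of the lower central series of
    [G / range (f l)] has exponent dividing [m], for all [l]
    ([chain_class_two]).

    Take members [A] and [B] of the chain with [A] inside [B], such that [B] acts
    trivially on the abelianization of [A] and [A] consists of [m]-th powers
    modulo commutators of [B], everything modulo later members of the chain.  In
    the nilpotent quotients [G / range (f l)] every element of [[A, B]] is an
    [m]-th power modulo [[[A, B], B]], while its order divides a power of [m].
    This makes [[A, B]] trivial ([frattini_central], [chain_commute]): in the
    limit [A] becomes abelian.  The commutators of [A] with all of [G] are then a
    finite set; this gives nilpotency and torsion commutators
    ([chain_quotient]), and a finitely generated torsion-free abelian group is
    free ([torsion_free_free_abelian]). *)

(** * Subgroups, homomorphisms and the lower central series *)

Section CommutatorIdentities.
Variable G : groupType.
Implicit Types x a b : G.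

Lemma commgMr x a b : [~ x, a * b] = [~ x, b] * [~ x, a] ^ b.
Proof. by rewrite /commg /conjg !gnorm. Qed.
Lemma commgMl x a b : [~ a * b, x] = [~ a, x] ^ b * [~ b, x].
Proof. by rewrite /commg /conjg !gnorm. Qed.
Lemma commgVr x a : [~ x, a^-1] = ([~ x, a] ^ a^-1)^-1.
Proof. by rewrite /commg /conjg !gnorm. Qed.
Lemma commgVl x a : [~ a^-1, x] = ([~ a, x] ^ a^-1)^-1.
Proof. by rewrite /commg /conjg !gnorm. Qed.
End CommutatorIdentities.

Section Subgroups.
Variables (G : groupType) (K : set G).
Hypothesis sK : is_subgroup K.

Lemma sub1 : K 1. Proof. by case: sK. Qed.
Lemma subM x y : K x -> K y -> K (x * y). Proof. by case: sK => _ + _; apply. Qed.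
Lemma subV x : K x -> K x^-1. Proof. by case: sK => _ _; apply. Qed.
Lemma subX x n : K x -> K (x ^+ n).
Proof. by move=> Kx; elim: n => [|n IH]; [exact: sub1 | rewrite expgS; apply: subM]. Qed.
Lemma subJ x y : K x -> K y -> K (x ^ y).
Proof. by move=> Kx Ky; apply: subM; [apply: subV | apply: subM]. Qed.
Lemma subR x y : K x -> K y -> K [~ x, y].
Proof. by move=> Kx Ky; apply: subM; [apply: subV | apply: subJ]. Qed.
Lemma subMl x y : K x -> K (x * y) -> K y.
Proof. by move=> Kx Kxy; rewrite -[y](mulKg x); apply: subM => //; apply: subV. Qed.

Lemma lcong_sym x y : K (x^-1 * y) -> K (y^-1 * x).
Proof. by move/subV; rewrite invgM invgK. Qed.
Lemma lcong_trans x y z : K (x^-1 * y) -> K (y^-1 * z) -> K (x^-1 * z).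
Proof. by move=> h1 h2; have := subM h1 h2; rewrite -mulgA mulVKg. Qed.
End Subgroups.

Definition normal_set (G : groupType) (K : set G) := forall x y, K x -> K (x ^ y).

Section Homs.
Variables (G H : groupType) (f : G -> H).
Hypothesis fM : {morph f : x y / x * y}.

Lemma hom1 : f 1 = 1.
Proof. by apply: (mulgI (f 1)); rewrite -fM !mulg1. Qed.
Lemma homV x : f x^-1 = (f x)^-1.
Proof. by apply: (mulgI (f x)); rewrite -fM !mulgV hom1. Qed.
Lemma homX n x : f (x ^+ n) = f x ^+ n.
Proof. by elim: n => [|n IH]; rewrite ?hom1 // !expgS fM IH. Qed.
Lemma homJ x y : f (x ^ y) = f x ^ f y.
Proof. by rewrite /conjg !fM homV. Qed.
Lemma homR x y : f [~ x, y] = [~ f x, f y].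
Proof. by rewrite !commgEl fM homV homJ. Qed.

Lemma preim_subgroup (K : set H) : is_subgroup K -> is_subgroup (f @^-1` K).
Proof.
move=> sK; split=> [|x y Kx Ky|x Kx]; rewrite /preimage /=.
- by rewrite hom1; apply: sub1.
- by rewrite fM; apply: subM.
- by rewrite homV; apply: subV.
Qed.

Lemma image_subgroup (K : set G) : is_subgroup K -> is_subgroup (f @` K).
Proof.
move=> sK; split=> [|_ _ [x Kx <-] [y Ky <-]|_ [x Kx <-]].
- by exists 1; [apply: sub1 | exact: hom1].
- by exists (x * y); [apply: subM | exact: fM].
- by exists x^-1; [apply: subV | exact: homV].
Qed.

End Homs.

Lemma decreasing_le T (L : nat -> set T) m n :
  (forall i, L i.+1 `<=` L i) -> (m <= n)%N -> L n `<=` L m.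
Proof.
move=> dL; elim: n => [|n IH]; first by rewrite leqn0 => /eqP->.
by rewrite leq_eqVlt => /orP[/eqP->//|/IH h x /dL]; apply: h.
Qed.

Lemma increasing_le T (L : nat -> set T) m n :
  (forall i, L i `<=` L i.+1) -> (m <= n)%N -> L m `<=` L n.
Proof.
move=> dL; elim: n => [|n IH]; first by rewrite leqn0 => /eqP->.
by rewrite leq_eqVlt => /orP[/eqP->//|/IH h x /h /dL].
Qed.

Lemma setT_subgroup (G : groupType) : is_subgroup [set: G].
Proof. by []. Qed.

Lemma trivial_subgroup (G : groupType) : is_subgroup [set (1 : G)].
Proof.
by split=> [|x y -> ->|x ->] //=; rewrite ?mulg1 ?invg1.
Qed.

Lemma range_subgroup (G H : groupType) (f : G -> H) :
  {morph f : x y / x * y} -> is_subgroup (range f).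
Proof. by move=> fM; apply: image_subgroup. Qed.

Lemma conj_hom (G : groupType) (y : G) : {morph (fun x => x ^ y) : a b / a * b}.
Proof. by move=> a b; rewrite conjMg. Qed.

Lemma setI_subgroup (G : groupType) (A B : set G) :
  is_subgroup A -> is_subgroup B -> is_subgroup (A `&` B).
Proof.
move=> sA sB; split=> [|x y [? ?] [? ?]|x [? ?]].
- by split; apply: sub1.
- by split; apply: subM.
- by split; apply: subV.
Qed.

Lemma generated_subgroup (G : groupType) (S : set G) : is_subgroup (generated S).
Proof.
split=> [M [sM _]|x y Sx Sy M MS|x Sx M MS].
- exact: sub1.
- by apply: subM; [case: MS | apply: Sx | apply: Sy].
- by apply: subV; [case: MS | apply: Sx].
Qed.

Lemma generated_ind (G : groupType) (S K : set G) :
  is_subgroup K -> S `<=` K -> generated S `<=` K.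
Proof. exact: smallest_sub. Qed.

Lemma mem_generated (G : groupType) (S : set G) x : S x -> generated S x.
Proof. by move=> Sx M [_]; apply. Qed.

Definition commset (G : groupType) (A B : set G) : set G :=
  generated [set [~ x, y] | x in A & y in B].

Lemma commset_subgroup (G : groupType) (A B : set G) : is_subgroup (commset A B).
Proof. exact: generated_subgroup. Qed.

Lemma mem_commset (G : groupType) (A B : set G) x y :
  A x -> B y -> commset A B [~ x, y].
Proof. by move=> Ax By; apply: mem_generated; exists x => //; exists y. Qed.

Lemma commset_ind (G : groupType) (A B K : set G) : is_subgroup K ->
  (forall x y, A x -> B y -> K [~ x, y]) -> commset A B `<=` K.
Proof. by move=> sK h; apply: generated_ind => // _ [x Ax [y By <-]]; apply: h. Qed.

Lemma commset_hom (G H : groupType) (f : G -> H) (A B : set G) (A' B' : set H) :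
  {morph f : x y / x * y} -> (forall x, A x -> A' (f x)) ->
  (forall x, B x -> B' (f x)) ->
  forall x, commset A B x -> commset A' B' (f x).
Proof.
move=> fM fA fB; apply: commset_ind => [|x y Ax By].
  by apply: (preim_subgroup fM); apply: commset_subgroup.
by rewrite /preimage /= (homR fM); apply: mem_commset; [apply: fA | apply: fB].
Qed.

Lemma commset_normal (G : groupType) (A B : set G) z :
  (forall x, A x -> A (x ^ z)) -> (forall x, B x -> B (x ^ z)) ->
  forall x, commset A B x -> commset A B (x ^ z).
Proof. by move=> hA hB; exact: (commset_hom (conj_hom z)). Qed.

Notation lcs := lower_central.

Lemma lcs_subgroup (G : groupType) n : is_subgroup (lcs G n).
Proof. by case: n => [|n]; [exact: setT_subgroup | exact: commset_subgroup]. Qed.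

Lemma lcs_hom (G H : groupType) (f : G -> H) n : {morph f : x y / x * y} ->
  forall x, lcs G n x -> lcs H n (f x).
Proof. by move=> fM; elim: n => [|n IH] //; exact: (commset_hom fM). Qed.

Lemma lcs_normal (G : groupType) n : normal_set (lcs G n).
Proof. by move=> x y; exact: (lcs_hom (conj_hom y)). Qed.

Lemma lcs_comm (G : groupType) n (x y : G) : lcs G n x -> lcs G n.+1 [~ x, y].
Proof. by move=> Gx; apply: mem_commset. Qed.

Lemma lcs_le (G : groupType) m n : (m <= n)%N -> lcs G n `<=` lcs G m.
Proof.
apply: decreasing_le => i; apply: commset_ind => [|x y Gx _]; first exact: lcs_subgroup.
rewrite commgEl; apply: (subM (lcs_subgroup G i)); last exact: lcs_normal.
exact: (subV (lcs_subgroup G i)).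
Qed.

Lemma lcs_surj (G H : groupType) (f : G -> H) n : {morph f : x y / x * y} ->
  (forall y, exists x, f x = y) -> lcs H n `<=` f @` lcs G n.
Proof.
move=> fM fs; elim: n => [|n IH]; first by move=> y _; have [x <-] := fs y; exists x.
apply: commset_ind => [|_ y' /IH[x Gx <-] _].
  by apply: (image_subgroup fM); apply: lcs_subgroup.
by have [y <-] := fs y'; exists [~ x, y]; [exact: lcs_comm | exact: homR].
Qed.

Lemma quotient_piE (G : groupType) (H : subgroup G) (nH : normal H) :
  let p (x : G) : quotient nH := \pi_(quotient nH)%qT x in
  [/\ {morph p : x y / x * y}, (forall y, exists x, p x = y)
    & forall x, p x = 1 <-> subgroup_set H x].
Proof.
move=> p; split=> [u v|y|u]; first by rewrite -[LHS](quotient_piM nH).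
  by exists (generic_quotient.repr y); exact: generic_quotient.reprK.
have := quotient_piP nH 1 u; rewrite /= invg1 mul1g => ->.
by split=> e; exact: esym e.
Qed.

(** Calculations modulo a normal subgroup [K] are done in an abstract group
    onto which [G] maps with kernel [K], so that congruences become equations
    and nothing depends on how the quotient is built. *)
Lemma quotient_hom (G : groupType) (K : set G) : is_subgroup K -> normal_set K ->
  exists (Q : groupType) (p : G -> Q), [/\ {morph p : x y / x * y},
    (forall y, exists x, p x = y) & forall x, p x = 1 <-> K x].
Proof.
move=> sK nK; pose S := Subgroup sK; have nS : normal S by move=> x y; apply: nK.
by have := quotient_piE nS; exists (quotient nS), (fun x => \pi_(quotient nS)%qT x).
Qed.

Lemma kernel_cong (G Q : groupType) (p : G -> Q) (K : set G) :
  {morph p : x y / x * y} -> (forall x, p x = 1 <-> K x) ->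
  forall x y, p x = p y <-> K (x^-1 * y).
Proof.
move=> pM pK x y; rewrite -pK pM (homV pM); split=> [->|h]; first by rewrite mulVg.
by apply: (mulgI (p x)^-1); rewrite h mulVg.
Qed.

(** * Index of a subgroup and stabilization *)

Section Index.
Variable G : groupType.
Implicit Types A B C : set G.

(** The index of [B] in [A] is bounded from above by translates of [B] that
    cover [A], and from below by elements of [A] that are pairwise incongruent
    modulo [B].  Neither notion mentions the type of cosets, and [B] need not
    lie inside [A]. *)
Definition covering A B n (r : 'I_n -> G) : Prop :=
  forall g, A g -> exists i, B ((r i)^-1 * g).

Definition packing A B n (r : 'I_n -> G) : Prop :=
  (forall i, A (r i)) /\ forall i j, B ((r i)^-1 * r j) -> i = j.

Definition index_le A B n : Prop := exists r : 'I_n -> G, covering A B r.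

Lemma index_leW A B n m : (n <= m)%N -> index_le A B n -> index_le A B m.
Proof.
move=> nm [r cr]; exists (fun i => if insub (val i) is Some j then r j else 1).
move=> g /cr[i Bi]; exists (widen_ord nm i).
by rewrite (_ : insub (val (widen_ord nm i)) = Some i) //; apply: (valK i).
Qed.

Lemma index_le_sub A A' B B' n :
  A' `<=` A -> B `<=` B' -> index_le A B n -> index_le A' B' n.
Proof.
by move=> AA BB [r cr]; exists r => g /AA/cr[i Bi]; exists i; apply: BB.
Qed.

(** The usual way to bound an index: attach to each element of [A] a colour
    from a finite set that determines its class modulo [B]. *)
Lemma color_index (F : finType) (col : G -> F) A B :
  (forall x y, A x -> A y -> col x = col y -> B (x^-1 * y)) -> index_le A B #|F|.
Proof.
move=> h.
pose r i := xget 1 [set g | A g /\ col g = @enum_val F F i].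
exists r => g Ag; exists (enum_rank (col g)).
have : [set g' | A g' /\ col g' = @enum_val F F (enum_rank (col g))] g.
  by rewrite /= enum_rankK.
by move/(@xgetI _ 1 _ _); rewrite -/(r _) => -[Ar e]; apply: h => //; rewrite e enum_rankK.
Qed.

Lemma index_color A B n : is_subgroup B -> index_le A B n ->
  exists col : G -> option 'I_n,
    forall x y, A x -> A y -> col x = col y -> B (x^-1 * y).
Proof.
move=> sB [r cr].
exists (fun g => [pick i | `[< B ((r i)^-1 * g) >]]) => x y Ax Ay.
case: pickP => [i /asboolP Bi|/(_ _)]; last first.
  by move=> h; have [i Bi] := cr _ Ax; move: (h i) => /asboolP.
case: pickP => [j /asboolP Bj [ij]|//]; subst j.
exact: (lcong_trans sB (lcong_sym sB Bi)).
Qed.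

Lemma packing_le A B n t (y : 'I_t -> G) :
  is_subgroup B -> index_le A B n -> packing A B y -> (t <= n)%N.
Proof.
move=> sB [r cr] [Ay yB].
have /boolp.choice[c hc] : forall i, exists j, B ((r j)^-1 * y i) by move=> i; apply: cr.
rewrite -[t]card_ord -[n]card_ord; apply: (@leq_card _ _ c) => i j ij.
apply: yB; apply: (lcong_trans sB (lcong_sym sB (hc i))); rewrite ij; exact: hc.
Qed.

(** A packing of maximal size covers.  The conclusion speaks of every packing of
    that size because in the Fitting argument below the image of a transversal
    under an endomorphism is again a packing, hence a transversal. *)
Lemma max_packing A B n : is_subgroup B ->
  (forall t (y : 'I_t -> G), packing A B y -> (t <= n)%N) ->
  exists t, [/\ (t <= n)%N, exists y : 'I_t -> G, packing A B y
     & forall y : 'I_t -> G, packing A B y -> covering A B y].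
Proof.
move=> sB hn.
pose P t := `[< exists y : 'I_t -> G, packing A B y >].
have exP : exists t, P t.
  by exists 0%N; apply/asboolP; exists (fun=> 1); split=> -[].
have ubP t : P t -> (t <= n)%N by move=> /asboolP[y /hn].
exists (ex_maxn exP ubP); case: ex_maxnP => t /asboolP Pt tmax.
split=> //; first by case: Pt => y /hn.
move=> y [yA yB] g Ag; apply: contrapT => ng.
suff: (t.+1 <= t)%N by rewrite ltnn.
apply: tmax; apply/asboolP.
pose y' (i : 'I_t.+1) := if unlift ord0 i is Some j then y j else g.
exists y'; split=> [i|i j]; rewrite /y'; first by case: unliftP.
case: unliftP => [i' ->|->]; case: unliftP => [j' ->|->] // h.
- by rewrite (yB _ _ h).
- by case: ng; exists i'.
- by case: ng; exists j'; apply: lcong_sym.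
Qed.

Lemma index_leP A B n : is_subgroup B ->
  (forall t (y : 'I_t -> G), packing A B y -> (t <= n)%N) -> index_le A B n.
Proof.
move=> sB /(max_packing sB)[t [tn [y py] cov]].
by apply: index_leW tn _; exists y; apply: cov.
Qed.

Lemma index_leM A B C n m : is_subgroup B ->
  index_le A B n -> index_le B C m -> index_le A C (n * m).
Proof.
move=> sB [r cr] [s cs].
have -> : (n * m)%N = #|{: 'I_n * 'I_m}| by rewrite card_prod !card_ord.
exists (fun k : 'I_(#|{: 'I_n * 'I_m}|) => let: ij := enum_val k in r ij.1 * s ij.2).
move=> g /cr[i /cs[j h]]; exists (enum_rank (i, j)).
by rewrite enum_rankK /= invgM -mulgA.
Qed.

Lemma index_le_power B n g : is_subgroup B -> index_le setT B n ->
  exists2 s, (0 < s <= n.+1)%N & B (g ^+ s).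
Proof.
move=> sB /(index_color sB)[col hcol].
have : ~~ injectiveb (fun i : 'I_n.+2 => col (g ^+ i)).
  apply/negP => /injectiveP/leq_card.
  by rewrite card_option !card_ord ltnn.
case/injectivePn => i [j ij e].
have key (a b : 'I_n.+2) : (a < b)%N -> col (g ^+ a) = col (g ^+ b) ->
    exists2 s, (0 < s <= n.+1)%N & B (g ^+ s).
  move=> ab ee; exists (b - a)%N.
    by rewrite subn_gt0 ab /= leq_subLR; apply: leq_trans (leq_addl _ _); rewrite -ltnS.
  have := hcol _ _ I I ee.
  by rewrite -{1}(subnKC (ltnW ab)) expgnDr mulKg.
case: (ltngtP i j) => h.
- exact: key h e.
- exact: key h (esym e).
- by move: ij; rewrite (val_inj h) eqxx.
Qed.

Lemma index_le_exponent B n : is_subgroup B -> index_le setT B n ->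
  exists2 e, (0 < e)%N & forall g, B (g ^+ e).
Proof.
move=> sB iB; exists (n.+1)`!; first exact: fact_gt0.
move=> g; have [s /andP[s0 sn] Bs] := index_le_power g sB iB.
have /dvdnP[q ->] : (s %| (n.+1)`!)%N by apply: dvdn_fact; rewrite s0 sn.
by rewrite mulnC expgnA; apply: subX.
Qed.

End Index.

Lemma index_le_image (G : groupType) (f : G -> G) (B : set G) n :
  {morph f : x y / x * y} -> index_le setT B n -> index_le (range f) (f @` B) n.
Proof.
move=> fM [r cr]; exists (f \o r) => _ [x _ <-].
have [i Bi] := cr x I; exists i; exists ((r i)^-1 * x) => //.
by rewrite fM (homV fM).
Qed.

Lemma index_le_preim (G : groupType) (f : G -> G) (B : set G) n :
  {morph f : x y / x * y} -> is_subgroup B ->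
  index_le setT B n -> index_le setT (f @^-1` B) n.
Proof.
move=> fM sB iB; apply: index_leP => [|t y [_ yB]]; first exact: preim_subgroup.
apply: (packing_le sB iB (y := f \o y)); split=> // i j /= h; apply: yB.
by rewrite /preimage /= fM (homV fM).
Qed.

Lemma finite_index_le (G : groupType) (H : subgroup G) :
  finite_index H -> exists n, index_le setT H n.
Proof.
move=> /finite_seqP[s hs].
exists (size s).
pose F (g : G) := [set g * h | h in subgroup_set H].
pose r (i : 'I_(size s)) := xget 1 [set g | F g = nth set0 s i].
exists r => g _.
have : range F (F g) by exists g.
rewrite hs /= => gs; have lt : (index (F g) s < size s)%N by rewrite index_mem.
exists (Ordinal lt).
have e : F (r (Ordinal lt)) = F g.
  have h := @xgetI _ 1 [set g' | F g' = nth set0 s (Ordinal lt)] g.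
  by rewrite -[RHS](nth_index set0 gs); apply: h; rewrite /= nth_index.
have : F (r (Ordinal lt)) g.
  by rewrite e; exists 1; [apply: sub1; case: (H) | rewrite mulg1].
by move: (r _) => a [h Hh <-]; rewrite mulKg.
Qed.

Lemma stable_decr (F : finType) (S : nat -> {set F}) :
  (forall n, S n.+1 \subset S n) -> exists k, forall n, (k <= n)%N -> S n = S k.
Proof.
move=> dS.
have ex : exists m, `[< exists k, #|S k| = m >] by exists #|S 0%N|; apply/asboolP; exists 0%N.
case: (ex_minnP ex) => m /asboolP[k km] mmin; exists k => n kn.
have sub : S n \subset S k.
  elim: n kn => [|n IH]; first by rewrite leqn0 => /eqP->.
  by rewrite leq_eqVlt => /orP[/eqP->//|/IH h]; exact: fintype.subset_trans (dS n) h.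
apply/eqP; rewrite eqEcard sub km mmin //; by apply/asboolP; exists n.
Qed.

Lemma stable_incr (F : finType) (S : nat -> {set F}) :
  (forall n, S n \subset S n.+1) -> exists k, forall n, (k <= n)%N -> S n = S k.
Proof.
move=> dS; have [n|k hk] := @stable_decr F (fun n => ~: S n); first by rewrite finset.setCS.
by exists k => n /hk /finset.setC_inj.
Qed.

Section Stab.
Variables (G : groupType) (K : set G) (N : nat) (L : nat -> set G).
Hypotheses (sK : is_subgroup K) (iK : index_le setT K N).

(** Since [K] has finite index, the images of the [L l] in the finite set of
    cosets of [K] stabilize; from then on [L k] lies in [L l * K] for all [l]. *)
Lemma decreasing_stab : (forall n, L n.+1 `<=` L n) ->
  exists k0, forall k l x, (k0 <= k)%N -> L k x -> exists2 y, L l y & K (y^-1 * x).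
Proof.
move=> dL.
have [col hcol] := index_color sK iK.
pose S n := [set c | `[< exists2 g, L n g & col g = c >]]%SET.
have [n|k0 hk0] := @stable_decr _ S.
  by apply/fintype.subsetP => c; rewrite !inE => -[g /dL Lg gc]; exists g.
exists k0 => k l x k0k Lx.
have [lk|kl] := leqP l k.
  by exists x; [exact: (decreasing_le dL lk) | rewrite mulVg; apply: sub1].
have : col x \in S l.
  have -> : S l = S k by rewrite !hk0 // (leq_trans k0k (ltnW kl)).
  by rewrite !inE; exists x.
by rewrite !inE => -[y Ly e]; exists y => //; apply: hcol.
Qed.

Lemma increasing_stab : (forall n, is_subgroup (L n)) -> K `<=` L 0%N ->
  (forall n, L n `<=` L n.+1) -> exists k0, forall k, (k0 <= k)%N -> L k = L k0.
Proof.
move=> sL K0 dL.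
have [col hcol] := index_color sK iK.
pose S n := [set c | `[< exists2 g, L n g & col g = c >]]%SET.
have [n|k0 hk0] := @stable_incr _ S.
  by apply/fintype.subsetP => c; rewrite !inE => -[g /dL Lg gc]; exists g.
exists k0 => k k0k; apply/seteqP; split=> x Lx; last exact: (increasing_le dL k0k).
have : col x \in S k0 by rewrite -(hk0 k k0k) !inE; exists x.
rewrite !inE => -[y Ly e]; have /K0 h := hcol y x I I e.
by rewrite -[x](mulVKg y); apply: subM => //; exact: (increasing_le dL (leq0n k0)).
Qed.

End Stab.

(** * Intersections of subgroups of bounded index; kernels of endomorphisms *)

Definition generates (G : groupType) d (x : 'I_d -> G) : Prop :=
  forall K, is_subgroup K -> (forall i, K (x i)) -> forall g, K g.

Lemma finitely_generatedP (G : groupType) :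
  finitely_generated G -> exists d (x : 'I_d -> G), generates x.
Proof.
move=> [S [/finite_seqP[s ->] gS]].
exists (size s), (fun i => nth 1 s i) => K sK Kx g.
have : generated [set` s] g by rewrite gS.
apply: generated_ind => // y /= ys.
have lt : (index y s < size s)%N by rewrite index_mem.
by have := Kx (Ordinal lt); rewrite /= nth_index.
Qed.

Section Core.
Variables (G : groupType) (d : nat) (x : 'I_d -> G).
Hypothesis gx : generates x.

Definition letter (a : 'I_d * bool) : G := if a.2 then x a.1 else (x a.1)^-1.
Definition word (w : seq ('I_d * bool)) : G := foldr (fun a g => letter a * g) 1 w.

Lemma word_cat u v : word (u ++ v) = word u * word v.
Proof. by elim: u => [|a u IH] /=; rewrite ?mul1g // IH mulgA. Qed.

Lemma word_surj g : exists w, word w = g.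
Proof.
suff [w _ wg] : range word g by exists w.
apply: (gx (K := range word)) => [|i]; last first.
  by exists [:: (i, true)] => //=; rewrite mulg1.
split=> [|_ _ [u _ <-] [v _ <-]|_ [u _ <-]]; first by exists [::].
  by exists (u ++ v) => //; rewrite word_cat.
exists (rev [seq (a.1, ~~ a.2) | a <- u]) => //.
elim: u => [|[i b] u IH] /=; first by rewrite invg1.
rewrite rev_cons -cats1 word_cat IH /= mulg1 invgM.
by case: b; rewrite /letter //= invgK.
Qed.

(** A finitely generated group has only finitely many subgroups of index at most
    [n], so their intersection has finite index.  It is mapped into itself by
    every endomorphism, the preimage of a subgroup of index at most [n] being
    another one. *)
Definition core n : set G :=
  [set g | forall H, is_subgroup H -> index_le setT H n -> H g].

Lemma core_subgroup n : is_subgroup (core n).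
Proof.
split=> [H sH _|a b Ka Kb H sH iH|a Ka H sH iH].
- exact: sub1.
- by apply: subM => //; [apply: Ka | apply: Kb].
- by apply: subV => //; apply: Ka.
Qed.

Lemma core_hom n (f : G -> G) g : {morph f : a b / a * b} -> core n g -> core n (f g).
Proof.
move=> fM Kg H sH iH; apply: (Kg (f @^-1` H)); first exact: preim_subgroup.
exact: index_le_preim.
Qed.

Lemma core_normal n : normal_set (core n).
Proof. by move=> g y; exact: (core_hom (conj_hom y)). Qed.

(** A subgroup [H] of index at most [n] is recognized by an automaton whose
    states are [n] translates covering [G] and whose letters are the generators and their
    inverses.  So the function that sends every automaton and starting state to
    the state reached along a word for [g] takes finitely many values, and it
    determines the class of [g] modulo all the [H] at once. *)
Lemma core_index n : exists N, index_le setT (core n) N.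
Proof.
have /boolp.choice[w hw] := word_surj.
pose D := {ffun ('I_d * bool) * 'I_n -> 'I_n}.
pose run (e : D) i u := foldr (fun a j => e (a, j)) i u.
pose col g : {ffun D * 'I_n -> 'I_n} := [ffun k => run k.1 k.2 (w g)].
exists #|{: {ffun D * 'I_n -> 'I_n}}|; apply: (color_index (col := col)).
move=> g g' _ _ e H sH [r cr].
have [i0 h0] := cr 1 I.
have /boolp.choice[delta hd] : forall k : ('I_d * bool) * 'I_n,
    exists j, H ((r j)^-1 * (letter k.1 * r k.2)) by move=> k; apply: cr.
pose E : D := [ffun k => delta k].
have inv u : H ((r (run E i0 u))^-1 * word u).
  elim: u => [|a u IH] //=.
  rewrite ffunE; have := hd (a, run E i0 u) => /= h.
  by have := subM sH h IH; rewrite -!mulgA mulVKg.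
have := congr1 (fun f : {ffun D * 'I_n -> 'I_n} => f (E, i0)) e; rewrite !ffunE /= => ee.
have := inv (w g); have := inv (w g'); rewrite !hw ee => h1 h2.
exact: lcong_trans (lcong_sym sH h2) h1.
Qed.

End Core.

Section Fitting.
Variables (G : groupType) (f : G -> G).
Hypothesis fM : {morph f : x y / x * y}.

Lemma iter_hom n : {morph (iter n f) : x y / x * y}.
Proof. by elim: n => [|n IH] x y //=; rewrite IH fM. Qed.

(** For an endomorphism of a finite group the kernel has as many elements as the
    image has cosets.  Here the finite group is [G] modulo [K]: a transversal
    [z] of [f @^-1` K] gives on the one hand distinct classes [z a * y b] modulo
    [K], on the other hand a covering by the classes [r i * f (z c)]. *)
Lemma index_kernel (K : set G) N s t (y : 'I_t -> G) :
  is_subgroup K -> (forall x, K x -> K (f x)) -> index_le setT K N ->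
  index_le setT (range f) s -> packing (f @^-1` K) K y -> (t <= s)%N.
Proof.
move=> sK Kf iK [r cr] [yM yK].
have sM := preim_subgroup fM sK.
have iM := index_le_sub (@classical_sets.subset_refl _ _) (Kf : K `<=` f @^-1` K) iK.
have [q [_ [z pz] /(_ z pz) cz]] :=
  max_packing sM (fun t' y' py => packing_le sM iM py).
have q0 : (0 < q)%N by have [[i lt] _] := cz 1 I; apply: leq_ltn_trans lt.
have /boolp.choice[c hc] : forall k : 'I_q * 'I_t, exists ij : 'I_s * 'I_q,
    K ((r ij.1 * f (z ij.2))^-1 * (z k.1 * y k.2)).
  move=> k; have [i [h _ hE]] := cr (z k.1 * y k.2) I.
  have [j hj] := cz h I; exists (i, j) => /=.
  by move: hj; rewrite /preimage /= fM (homV fM) hE invgM !mulgA.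
have cI : injective c.
  move=> [a b] [a' b'] e; have := hc (a', b'); rewrite -e => h1.
  have := lcong_trans sK (lcong_sym sK (hc (a, b))) h1; rewrite /= invgM => h2.
  have ea : a = a'.
    apply: pz.2; have := subM sM (subM sM (yM b) (Kf _ h2)) (subV sM (yM b')).
    by rewrite !mulgA mulgK mulgV mul1g.
  by subst a'; congr (_, _); apply: yK; rewrite -!mulgA mulKg in h2.
have := leq_card _ cI; rewrite !card_prod !card_ord mulnC leq_pmul2r //.
Qed.

(** An element [g] acts by conjugation on the finite set [M] modulo [M'], and the
    elements that act trivially on it form a subgroup whose index is bounded by
    the number of self-maps of that set. *)
Lemma act_index (M M' : set G) s : is_subgroup M -> is_subgroup M' ->
  normal_set M -> normal_set M' -> M' `<=` M ->
  (forall t (y : 'I_t -> G), packing M M' y -> (t <= s)%N) ->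
  let H := [set g | forall x, M x -> M' [~ x, g]] in
  is_subgroup H /\ index_le setT H (s.+1 ^ s.+1).
Proof.
move=> sM sM' nM nM' M'M hs H.
have sH : is_subgroup H.
  split=> [x _|a b Ha Hb x Mx|a Ha x Mx].
  - by rewrite commg1; apply: sub1.
  - by rewrite commgMr; apply: subM => //; [apply: Hb | apply: nM'; apply: Ha].
  - by rewrite commgVr; apply: subV => //; apply: nM'; apply: Ha.
split=> //.
have [t [ts [y [yM yM']] cov]] := max_packing sM' hs.
have {}cov := cov y (conj yM yM').
have t0 : (0 < t)%N by have [[i lt] _] := cov _ (sub1 sM); apply: leq_ltn_trans lt.
have /boolp.choice[c hc] : forall k : G * 'I_t, exists b, M' ((y b)^-1 * (y k.2) ^ k.1).
  by move=> k; apply: cov; apply: nM.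
pose col g : {ffun 'I_t -> 'I_t} := [ffun a => c (g, a)].
suff: index_le setT H #|{: {ffun 'I_t -> 'I_t}}|.
  apply: index_leW; rewrite card_ffun !card_ord.
  apply: (@leq_trans (s.+1 ^ t)); first by rewrite leq_exp2r // ltnW.
  by rewrite leq_pexp2l // ltnW.
apply: (color_index (col := col)) => g g' _ _ e.
have same a : M' (((y a) ^ g)^-1 * (y a) ^ g').
  have := congr1 (fun f : {ffun 'I_t -> 'I_t} => f a) e; rewrite !ffunE => ee.
  have := hc (g', a); rewrite -ee; apply: (lcong_trans sM'); apply: (lcong_sym sM').
  exact: (hc (g, a)).
have same' x : M x -> M' ((x ^ g)^-1 * x ^ g').
  move=> /cov[a]; rewrite -{2 3}[x](mulVKg (y a)); move: (_ * x) => u Mu.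
  rewrite !conjMg invgM -mulgA; apply: subM => //.
    by apply: subV => //; apply: nM'.
  by rewrite mulgA; apply: subM => //; apply: nM'.
move=> x Mx; have := same' _ (nM _ g^-1 Mx).
by rewrite -!conjgM mulVg conjg1 commgEl.
Qed.

End Fitting.

(** * Normal embeddings of finite index *)

Section NormalEmbedding.
Variables (G : groupType) (d : nat) (x : 'I_d -> G) (f : G -> G) (s : nat).
Hypotheses (gx : generates x) (fM : {morph f : x y / x * y}).
Hypotheses (f_inj : injective f) (nR : normal_set (range f)).
Hypothesis iR : index_le setT (range f) s.

Let pre (K : set G) i : set G := iter i f @^-1` K.

Let preS n i : pre (core n) i `<=` pre (core n) i.+1.
Proof. by move=> g h; exact: (core_hom fM h). Qed.

Let pre_le n i j : (i <= j)%N -> pre (core n) i `<=` pre (core n) j.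
Proof. exact: (increasing_le (@preS n)). Qed.

Let pre_subgroup n i : is_subgroup (pre (core n) i).
Proof. by apply: (preim_subgroup (iter_hom fM i)); apply: core_subgroup. Qed.

Let pre_normal n i : normal_set (pre (core n) i).
Proof.
by move=> g y; rewrite /pre /preimage /= (homJ (iter_hom fM i)); apply: core_normal.
Qed.

Let pre_stab n : exists l, forall i, (l <= i)%N -> pre (core n) i = pre (core n) l.
Proof.
have [N iN] := core_index gx n.
apply: (increasing_stab (L := pre (core n)) (@core_subgroup G n) iN); [exact: pre_subgroup|by []|exact: preS].
Qed.

Let iterR l : exists n, index_le setT (range (iter l f)) n.
Proof.
elim: l => [|l [n iln]].
  exists 1%N, (fun=> 1) => g _; exists ord0; exists g => //=.
  by rewrite invg1 mul1g.
exists (n * s)%N; apply: (index_leM (B := range (iter l f))) => //.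
  exact: (range_subgroup (iter_hom fM l)).
apply: index_le_sub (index_le_image (iter_hom fM l) iR) => // _ [_ [g _ <-] <-].
by exists g => //; rewrite iterSr.
Qed.

Let index_step n i t (y : 'I_t -> G) :
  packing (pre (core n) i.+1) (pre (core n) i) y -> (t <= s)%N.
Proof.
move=> [yM yK]; have [N iN] := core_index gx n.
have Kf g : core n g -> core n (f g) by exact: (core_hom fM).
apply: (index_kernel fM (@core_subgroup G n) Kf iN iR (y := iter i f \o y)).
split=> [a|a b h]; first exact: (yM a).
by apply: yK; rewrite /pre /preimage /= (iter_hom fM i) (homV (iter_hom fM i)).
Qed.

(* The bound of [act_index]; it depends on the index [s] of the range only. *)
Let m := (s.+1 ^ s.+1)%N.

Let core_acts n i g y : core m g -> pre (core n) i.+1 y -> pre (core n) i [~ y, g].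
Proof.
have [sH iH] := act_index (pre_subgroup n i.+1) (pre_subgroup n i)
  (@pre_normal n i.+1) (@pre_normal n i) (@preS n i) (@index_step n i).
by move=> h; apply: (h _ sH iH).
Qed.

(** Write [M i] for the preimage of a core [core n] under the [i]-th iterate of
    [f].  The quotients [M i.+1 / M i] embed by [iter i f] in [M 1 / M 0], so
    they have at most [s] elements, for all [i] and [n]; hence one subgroup
    [core m] of finite index acts trivially on all of them.  Let [l] be such that
    the preimages of [core m] are constant from [l] on.  Then [iter l f] maps the
    stable term [M j] into [core m], and so lets [M j] act on its own filtration
    nilpotently.  As in Fitting's decomposition, [M j] and the range of [f]
    generate [G].  Hence a long commutator in [G] is, modulo the range, an element
    [v] with [iter l f v] in [core n], and [n] is chosen so large that this forces
    [v] into the range. *)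
Lemma normal_embedding_nilpotent : exists c, lcs G c `<=` range f.
Proof.
have [l hl] := pre_stab m; have [N0 iN0] := core_index gx m.
have [N1 iN1] := iterR l.+1.
pose n := maxn N0 N1.
have coreW : (core n : set G) `<=` core m.
  move=> g h; exact: (h (core m) (@core_subgroup G m) (index_leW (leq_maxl _ _) iN0)).
have coreR : core n `<=` range (iter l.+1 f).
  move=> g h; exact: (h _ (range_subgroup (iter_hom fM l.+1)) (index_leW (leq_maxr _ _) iN1)).
have [j hj] := pre_stab n.
pose M i := pre (core n) i.
have fl_core g : M j g -> core m (iter l f g).
  move=> Mg; have : pre (core m) j g by apply: coreW.
  by case: (leqP j l) => [jl /(pre_le jl)|/ltnW/hl ->].
have act i g y : M j g -> M i.+1 y -> M i [~ y, iter l f g].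
  by move=> /fl_core; apply: core_acts.
(* Fitting's decomposition: [iter j.+1 f] is injective modulo [M j], because
   [M (j + j.+1) = M j]; by finiteness it is also surjective. *)
have cover g : exists2 v, M j v & range f (v^-1 * g).
  have [N iN] := core_index gx n.
  have iM : index_le setT (M j) N.
    by apply: index_le_sub iN => //; apply: (pre_le (leq0n j)).
  have [t [_ [y [_ yM]] cov]] := max_packing (pre_subgroup n j)
    (fun t y py => packing_le (pre_subgroup n j) iM (y := y) py).
  have [|a ha] := cov (iter j.+1 f \o y) _ g I.
    split=> // a b /= h; apply: yM.
    have : M (j + j.+1)%N ((y a)^-1 * y b).
      rewrite /M /pre /preimage /= iterD.
      by rewrite (iter_hom fM j.+1) (homV (iter_hom fM j.+1)).
    by rewrite /M hj // leq_addr.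
  pose r := iter j.+1 f (y a); exists (g * r^-1).
    have := pre_normal r^-1 ha; rewrite /conjg invgK.
    by rewrite /= -/r mulgA mulVKg.
  by rewrite invgM invgK mulgVK; exists (iter j f (y a)).
(* Each further commutator moves [iter l f v] one step down the filtration. *)
have [Q [p [pM _ pK]]] := quotient_hom (range_subgroup fM) nR.
pose L i : set G := M j `&` (iter l f @^-1` M i).
have sL i : is_subgroup (L i).
  apply: setI_subgroup; first exact: pre_subgroup.
  by apply: (preim_subgroup (iter_hom fM l)); apply: pre_subgroup.
have pcover g : exists2 v, M j v & p v = p g.
  have [v Mv /pK] := cover g; rewrite pM (homV pM) => h; exists v => //.
  by apply: (mulgI (p v)^-1); rewrite h mulVg.
have main i : (i <= j)%N -> forall u, lcs G i u -> (p @` L (j - i)%N) (p u).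
  elim: i => [_ u _|i IH lt].
    have [v Mv <-] := pcover u; exists v => //; split=> //.
    rewrite subn0 /preimage /= /M /pre /preimage /= -iterD addnC iterD.
    by apply: (core_hom (iter_hom fM l)).
  apply: commset_ind => [|u g /(IH (ltnW lt))[v [Mv Lv] vu] _].
    by apply: (preim_subgroup pM); apply: (image_subgroup pM).
  have [w Mw wg] := pcover g; rewrite /preimage /= (homR pM) -wg -vu -(homR pM).
  exists [~ v, w] => //; split; first exact: (subR (pre_subgroup n j)).
  rewrite /preimage /= (homR (iter_hom fM l)); apply: act => //.
  by rewrite -subSn.
exists j => u /(main j (leqnn j))[v [Mv]]; rewrite subnn /preimage /= => /coreR[w _ /=].
have iter_inj : injective (iter l f) by elim: (l) => [|k IH] // a b /= /f_inj /IH.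
rewrite -iterS iterSr => /iter_inj vw vu.
by apply/pK; rewrite -vu; apply/pK; exists w.
Qed.
End NormalEmbedding.

(** * Finitely generated abelian groups relative to a subgroup *)

Section ZeroSubgroup.
Variable V : zmodType.

Lemma zero_sub0 : [set (0 : V)%R] 0%R. Proof. by []. Qed.
Lemma zero_subB (u v : V) :
  [set (0 : V)%R] u -> [set (0 : V)%R] v -> [set (0 : V)%R] (u - v)%R.
Proof. by move=> -> ->; rewrite /= GRing.subrr. Qed.
End ZeroSubgroup.

Section Lattice.
Import GRing.Theory Num.Theory Order.TTheory.
Local Open Scope ring_scope.

Variables (V : zmodType) (R : set V).
Hypotheses (R0 : R 0) (RB : forall u v, R u -> R v -> R (u - v)).

Let RN u : R u -> R (- u). Proof. by move=> /(RB R0); rewrite sub0r. Qed.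
Let RD u v : R u -> R v -> R (u + v).
Proof. by move=> Ru /RN Rv; rewrite -[v]opprK; apply: RB. Qed.
Let RMn u n : R u -> R (u *+ n).
Proof. by move=> Ru; elim: n => [|n IH] //; rewrite mulrS; apply: RD. Qed.

(** Torsion relative to a subgroup [R]: this covers quotients of [V] without
    forming them. *)
Definition tors : set V := [set v | exists2 m, (0 < m)%N & R (v *+ m)].

Lemma torsB u v : tors u -> tors v -> tors (u - v).
Proof.
move=> [m m0 Rm] [n n0 Rn]; exists (m * n)%N; first by rewrite muln_gt0 m0.
by rewrite mulrnBl mulrnA mulnC mulrnA; apply: RB; apply: RMn.
Qed.

Lemma tors_sub u : R u -> tors u. Proof. by move=> Ru; exists 1%N. Qed.
Lemma torsN u : tors u -> tors (- u).
Proof. by move=> h; rewrite -sub0r; apply: torsB => //; apply: tors_sub. Qed.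
Lemma torsD u v : tors u -> tors v -> tors (u + v).
Proof. by move=> Ru /torsN Rv; rewrite -[v]opprK; apply: torsB. Qed.

Lemma torsMz u (c : int) : tors u -> tors (u *~ c).
Proof.
move=> tu; have tn n : tors (u *+ n).
  by elim: n => [|n IH]; [exact: tors_sub | rewrite mulrS; apply: torsD].
by case: c => n; [exact: tn | rewrite NegzE mulrNz; apply: torsN; exact: tn].
Qed.

Lemma tors_divMz u (c : int) : c != 0 -> tors (u *~ c) -> tors u.
Proof.
move=> c0 [m m0 Rm]; exists (`|c| * m)%N; first by rewrite muln_gt0 absz_gt0 c0.
rewrite mulrnA; case: c c0 Rm => n c0; first by [].
by rewrite NegzE mulrNz mulNrn => /RN; rewrite opprK.
Qed.

Definition comb r (S : 'I_r -> V) (a : 'rV[int]_r) : V := \sum_i S i *~ a 0 i.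

Lemma combB r (S : 'I_r -> V) a b : comb S (a - b) = comb S a - comb S b.
Proof.
rewrite /comb -sumrB; apply: eq_bigr => i _.
by rewrite !mxE mulrzBr.
Qed.

Lemma comb_mul q r (S : 'I_r -> V) (M : 'M[int]_(q, r)) a :
  comb (fun i => comb S (row i M)) a = comb S (a *m M).
Proof.
rewrite /comb.
under eq_bigr => i _ do rewrite mulrz_suml.
rewrite exchange_big /=; apply: eq_bigr => j _.
rewrite mxE mulrz_sumr; apply: eq_bigr => i _.
by rewrite mxE -mulrzA mulrC.
Qed.

Lemma tors_comb r (S : 'I_r -> V) a : (forall i, tors (S i)) -> tors (comb S a).
Proof.
move=> h; rewrite /comb; elim/big_rec: _ => [|i v _ tv]; first exact: tors_sub.
by apply: torsD => //; apply: torsMz.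
Qed.

Definition tors_generators r (S : 'I_r -> V) := forall v, exists a, tors (v - comb S a).

(** A family of minimal length that generates [V] up to torsion modulo [R] is
    independent: by Smith's normal form of the row [a], a relation with
    coefficients [a] says, after a unimodular change of the family, that a
    nonzero multiple of its first member is torsion; this member can be dropped. *)
Lemma tors_generators_free n (x : 'I_n -> V) : tors_generators x -> exists r (S : 'I_r -> V),
  tors_generators S /\ forall a, tors (comb S a) -> a = 0.
Proof.
move=> gx.
have ex : exists r, `[< exists S : 'I_r -> V, tors_generators S >].
  by exists n; apply/asboolP; exists x.
case: (ex_minnP ex) => r /asboolP[S gS] rmin; exists r, S; split=> // a ta.
apply/eqP/negPn/negP => a0.
suff: (r <= r.-1)%N.
  case: r S gS rmin a ta a0 => [|r] S gS rmin a ta a0; last by rewrite ltnn.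
  by move: a0; rewrite (thinmx0 a) eqxx.
apply: rmin; apply/asboolP.
have [L Lu [M Mu [s _ aE]]] := int_Smith_normal_form a.
case: r => [|r] in S gS a ta a0 M Mu aE *; first by move: a0; rewrite (thinmx0 a) eqxx.
pose g := L 0 0 * s`_0.
have aE' : a = (g *: delta_mx 0 0) *m M.
  rewrite aE; congr (_ *m _); apply/rowP => j; rewrite !mxE big_ord1 !mxE /g.
  by case: j => [[|j] lt] //=; rewrite ?mulr1n ?mulr0n ?mulr1 ?mulr0.
have g0 : g != 0.
  by apply: contraNneq a0 => g0; rewrite aE' g0 scale0r mul0mx.
pose T i := comb S (row i M).
have tT0 : tors (T 0).
  apply: (tors_divMz g0); move: ta; rewrite aE' -comb_mul -/T.
  rewrite /comb (bigD1 ord0) //= big1 => [|i i0]; last first.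
    by rewrite !mxE (negbTE i0) mulr0 mulr0z.
  by rewrite !mxE eqxx mulr1 addr0.
exists (fun i => T (fintype.lift ord0 i)) => v.
have [b tb] := gS v; pose c := b *m invmx M.
exists (\row_i c 0 (fintype.lift ord0 i)).
set X := comb _ _; have h : comb S b = X + T 0 *~ c 0 0.
  rewrite -[b](mulmxKV Mu) -/c -comb_mul -/T /X /comb big_ord_recl [RHS]addrC; congr (_ + _).
  by apply: eq_bigr => i _; rewrite [in RHS]mxE.
have -> : (v - X = (v - comb S b) + T 0 *~ c 0 0)%R by rewrite h opprD addrA subrK.
by apply: torsD => //; apply: torsMz.
Qed.


Let combD r (S T : 'I_r -> V) a :
  comb (fun i => S i + T i) a = comb S a + comb T a.
Proof. by rewrite /comb -big_split; apply: eq_bigr => i _; rewrite mulrzDl. Qed.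

Let comb_mulrn r (S : 'I_r -> V) a n : comb S a *+ n = comb (fun i => S i *+ n) a.
Proof.
by rewrite /comb -sumrMnl; apply: eq_bigr => i _; rewrite !pmulrn mulrzAC.
Qed.

Let comb_R r (S : 'I_r -> V) a : (forall i, R (S i)) -> R (comb S a).
Proof.
move=> h; rewrite /comb; elim/big_rec: _ => [|i v _ Rv] //; apply: RD => //.
case: (a 0 i) => n; first exact: RMn.
by rewrite NegzE mulrNz; apply: RN; exact: RMn.
Qed.

Section Generated.
Variables (n : nat) (x : 'I_n -> V).
Hypothesis gx : forall v, exists a, v = comb x a.

Lemma generators_tors : tors_generators x.
Proof. by move=> v; have [a ->] := gx v; exists a; rewrite subrr; apply: tors_sub. Qed.

(** The generators agree with combinations of the free family [S] up to torsion
    elements; an exponent for these finitely many errors works for all torsion. *)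
Lemma tors_exponent : exists2 e, (0 < e)%N & forall v, tors v -> R (v *+ e).
Proof.
have [r [S [gS fS]]] := tors_generators_free generators_tors.
have /boolp.choice[c hc] : forall i, exists a, tors (x i - comb S a) by move=> i; apply: gS.
have /boolp.choice[m hm] : forall i, exists m, (0 < m)%N /\ R ((x i - comb S (c i)) *+ m).
  by move=> i; have [m m0 Rm] := hc i; exists m.
pose e := (\prod_i m i)%N.
exists e => [|v tv]; first by rewrite prodn_gt0 // => i; have [] := hm i.
have [a va] := gx v.
pose M : 'M[int]_(n, r) := \matrix_(i, j) c i 0 j.
have cE i : row i M = c i by apply/rowP => j; rewrite !mxE.
pose T i := x i - comb S (row i M).
have vE : v = comb T a + comb S (a *m M).
  rewrite -comb_mul -combD va; congr comb; apply/funext => i; by rewrite /T subrK.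
have Rm i : R (T i *+ e).
  rewrite /e (bigD1 i) //= mulrnA; apply: RMn; rewrite /T cE.
  by have [] := hm i.
have tT : tors (comb T a) by apply: tors_comb => i; rewrite /T cE.
have aM0 : a *m M = 0.
  by apply: fS; have := torsB tv tT; rewrite vE addrAC subrr add0r.
rewrite vE aM0 {2}/comb big1 => [|i _]; last by rewrite mxE mulr0z.
by rewrite addr0 comb_mulrn; apply: comb_R.
Qed.

(** There are finitely many torsion classes: with [e] the exponent, two torsion
    elements whose coordinates agree modulo [e] differ by [e] times an element
    that is itself torsion. *)
Lemma tors_classes : exists (F : finType) (col : V -> F),
  forall u v, tors u -> tors v -> col u = col v -> R (u - v).
Proof.
have [[//|e] _ he] := tors_exponent.
have /boolp.choice[c hc] := gx.
pose col v : {ffun 'I_n -> 'I_e.+1} := [ffun i => inord `|(c v 0%R i %% e.+1)%Z|].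
exists {ffun 'I_n -> 'I_e.+1}, col => u v tu tv ee.
have em i : (c u 0%R i = c v 0%R i %[mod e.+1])%Z.
  have := congr1 (fun f : {ffun 'I_n -> 'I_e.+1} => val (f i)) ee; rewrite !ffunE /=.
  have lt w : (`|(c w 0%R i %% e.+1)%Z| < e.+1)%N.
    by rewrite -ltz_nat gez0_abs ?ltz_pmod // modz_ge0.
  by rewrite !inordK // => /(congr1 Posz); rewrite !gez0_abs // modz_ge0.
pose w : 'rV[int]_n := \row_i ((c u 0%R i - c v 0%R i) %/ e.+1)%Z.
have uv : u - v = comb x w *+ e.+1.
  rewrite {1}(hc u) {1}(hc v) -combB comb_mulrn; apply: eq_bigr => i _.
  rewrite !mxE pmulrn -mulrzA mulrC divzK //.
  by rewrite -eqz_mod_dvd; apply/eqP.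
rewrite uv; apply: he; apply: (@tors_divMz _ e.+1) => //.
by have := torsB tu tv; rewrite uv.
Qed.

(** In coordinates modulo torsion [th] is a square integer matrix [M].  If its
    cokernel is torsion, then [N *m M] is diagonal and nonsingular for some
    integer matrix [N], so [M] is injective. *)
Lemma tors_kernel (th : V -> V) : {morph th : u v / u - v} ->
  (forall v, R v -> R (th v)) ->
  (forall v, exists2 s, (0 < s)%N & exists u, R (v *+ s - th u)) ->
  forall v, tors (th v) -> tors v.
Proof.
move=> thB thR coker.
have th0 : th 0 = 0 by have := thB 0 0; rewrite !subrr.
have thN u : th (- u) = - th u by rewrite -sub0r thB th0 sub0r.
have thD u v : th (u + v) = th u + th v by rewrite -{1}[v]opprK thB thN opprK.
have thMn u m : th (u *+ m) = th u *+ m by elim: m => [|m IH] //; rewrite !mulrS thD IH.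
have thMz u (c : int) : th (u *~ c) = th u *~ c.
  by case: c => m; [exact: thMn | rewrite NegzE !mulrNz thN; congr (- _); exact: thMn].
have thcomb q (S : 'I_q -> V) a : th (comb S a) = comb (th \o S) a.
  by rewrite /comb (big_morph th thD th0); apply: eq_bigr => i _; rewrite thMz.
have tth v : tors v -> tors (th v) by move=> [m m0 Rm]; exists m; rewrite // -thMn; apply: thR.
have [r [S [gS fS]]] := tors_generators_free generators_tors.
have /boolp.choice[a ha] := gS.
pose M : 'M[int]_r := \matrix_(i, j) a (th (S i)) 0 j.
have ME i : row i M = a (th (S i)) by apply/rowP => j; rewrite !mxE.
have key v : tors (th v - comb S (a v *m M)).
  rewrite -comb_mul -[th v](subrK (th (comb S (a v)))) -thB -addrA.
  apply: torsD; first exact: tth.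
  rewrite thcomb -[X in X - _]add0r.
  have -> : comb (th \o S) (a v) =
      comb (fun i => th (S i) - comb S (row i M)) (a v)
        + comb (fun i => comb S (row i M)) (a v).
    by rewrite -combD; congr comb; apply/funext => i; rewrite /= subrK.
  by rewrite add0r addrK; apply: tors_comb => i; rewrite ME.
have /boolp.choice[k hk] : forall i, exists k : nat * V,
    (0 < k.1)%N /\ R (S i *+ k.1 - th k.2).
  by move=> i; have [s s0 [u Ru]] := coker (S i); exists (s, u).
pose N : 'M[int]_r := \matrix_(i, j) a (k i).2 0 j.
have NE i : row i N = a (k i).2 by apply/rowP => j; rewrite !mxE.
have NM : N *m M = diag_mx (\row_i (k i).1%:Z).
  apply/row_matrixP => i; apply/eqP; rewrite -subr_eq0; apply/eqP.
  rewrite row_mul NE row_diag_mx mxE -oppr0 -opprB; congr (- _); apply: fS.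
  rewrite combB; have : comb S ((k i).1%:Z *: delta_mx 0 i) = S i *+ (k i).1.
    rewrite /comb (bigD1 i) //= big1 => [|j ji]; last first.
      by rewrite !mxE (negbTE ji) mulr0 mulr0z.
    by rewrite !mxE !eqxx mulr1 addr0.
  move=> ->; have [_ Rk] := hk i.
  by have := torsD (tors_sub Rk) (key (k i).2); rewrite addrA subrK.
have dM : \det M != 0.
  have := congr1 determinant NM; rewrite det_mulmx det_diag => h.
  have : \prod_i (\row_i (k i).1%:Z) 0 i != 0 :> int.
    by apply/prodf_neq0 => i _; rewrite mxE; have [] := hk i; case: (k i).1.
  by rewrite -h mulf_eq0 negb_or => /andP[].
move=> v tv.
have aM : a v *m M = 0.
  by apply: fS; have := torsB tv (key v); rewrite opprB addrCA subrr addr0.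
have a0 : a v = 0.
  have : a v *m (M *m \adj M) = 0 by rewrite mulmxA aM mul0mx.
  rewrite mul_mx_adj mul_mx_scalar => /eqP.
  by rewrite scalemx_eq0 (negbTE dM) => /eqP.
have := ha v; rewrite a0 {1}/comb big1 ?subr0 // => i _.
by rewrite mxE mulr0z.
Qed.

End Generated.

End Lattice.

(** * Abelian sections of a group *)

Lemma abelian_zmod (Q : groupType) : (forall x y : Q, x * y = y * x) ->
  exists (V : zmodType) (i : Q -> V) (j : V -> Q),
    [/\ forall x y, i (x * y) = (i x + i y)%R, cancel i j & cancel j i].
Proof.
move=> QC.
pose V : zmodType := HB.pack (monoid.Group.sort Q)
  (GRing.isZmodule.Build (monoid.Group.sort Q) (@mulgA Q) QC (@mul1g Q) (@mulVg Q)).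
by exists V, (fun x : Q => x : V), (fun x : V => x : Q).
Qed.

(** An abelian quotient of a subgroup [H] as an additive group.  The map [p] is
    defined on all of [G], but it is meaningful on [H] only. *)
Lemma abelian_section (G : groupType) (H L : set G) :
  is_subgroup H -> is_subgroup L -> L `<=` H ->
  (forall x y, H x -> H y -> L [~ x, y]) ->
  exists (V : zmodType) (p : G -> V),
    [/\ forall x y, H x -> H y -> p (x * y) = (p x + p y)%R,
        forall v, exists2 x, H x & p x = v
      & forall x, H x -> (p x = 0%R <-> L x)].
Proof.
move=> sH sL LH HL.
pose T : groupType := subgroup_type (Subgroup sH).
pose L' : set T := (val : T -> G) @^-1` L.
have valH (t : T) : H (val t) by have /set_mem := valP t.
have sL' : is_subgroup L' by apply: preim_subgroup.
have nL' : normal_set L'.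
  move=> x y Lx; have := subM sL Lx (HL _ _ (valH x) (valH y)).
  by rewrite commgEl mulVKg.
have [Q [q [qM qS qK]]] := quotient_hom sL' nL'.
have QC (a b : Q) : a * b = b * a.
  have [x <-] := qS a; have [y <-] := qS b.
  rewrite commgC; apply/eqP; rewrite -[X in _ == X]mulg1; apply/eqP; congr (_ * _).
  by rewrite -(homR qM); apply/qK; apply: HL; apply: valH.
have [V [i [j [iM ij ji]]]] := abelian_zmod QC.
pose r (x : G) : T := insubd 1 x.
have rE x : H x -> val (r x) = x.
  by move=> Hx; rewrite /r insubdK //; apply/mem_set.
have i1 : i 1 = 0%R.
  by apply: (@GRing.addrI _ (i 1)); rewrite -iM mulg1 GRing.addr0.
exists V, (fun x => i (q (r x))); split.
- move=> x y Hx Hy; rewrite -iM -qM; congr (i (q _)); apply: val_inj.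
  by rewrite /= !rE //; apply: subM.
- move=> v; have [t tE] := qS (j v); exists (val t); first exact: valH.
  by rewrite -[RHS]ji -tE; congr (i (q _)); apply: val_inj; rewrite rE //; apply: valH.
- move=> x Hx; rewrite -{2}(rE _ Hx) -[L _]/(L' (r x)) -qK -i1.
  by split=> [/(can_inj ij)|->].
Qed.

(** * Exponents in nilpotent groups *)

Lemma commg_eq1 (G : groupType) (x y : G) : [~ x, y] = 1 <-> commute x y.
Proof. by split=> [/eqP/commgP|/commgP/eqP]. Qed.

Lemma commute_conj (G : groupType) (x y : G) : commute x y -> x ^ y = x.
Proof. by move=> xy; rewrite /conjg xy mulKg. Qed.

Lemma commXg_central (G : groupType) (x y : G) n :
  commute [~ x, y] x -> [~ x ^+ n, y] = [~ x, y] ^+ n.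
Proof.
move=> h; elim: n => [|n IH]; first by rewrite !expg0 comm1g.
by rewrite expgS commgMl IH commute_conj ?expgS //; apply: commuteX.
Qed.

Lemma commgX_central (G : groupType) (x y : G) n :
  commute [~ x, y] y -> [~ x, y ^+ n] = [~ x, y] ^+ n.
Proof.
move=> h; elim: n => [|n IH]; first by rewrite !expg0 commg1.
rewrite expgSr commgMr IH commute_conj ?expgS //.
by apply/commute_sym/commuteX/commute_sym.
Qed.

Lemma lcs_quotient (G : groupType) n : exists (Q : groupType) (p : G -> Q),
  [/\ {morph p : x y / x * y}, forall y, exists x, p x = y,
      forall x, p x = 1 <-> lcs G n.+1 x
    & forall x y, lcs G n x -> commute (p x) (p y)].
Proof.
have [Q [p [pM pS pK]]] := quotient_hom (lcs_subgroup G n.+1) (@lcs_normal G n.+1).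
exists Q, p; split=> // x y Gx; apply/commg_eq1.
by rewrite -(homR pM); apply/pK; apply: lcs_comm.
Qed.

Lemma lcs_power_subgroup (G : groupType) m i :
  is_subgroup [set u | lcs G i u /\ lcs G i.+1 (u ^+ m)].
Proof.
have [Q [p [pM _ pK pZ]]] := lcs_quotient G i.
have sG := lcs_subgroup G i.
split=> [|u v [Gu hu] [Gv hv]|u [Gu hu]] /=.
- by split; [exact: sub1 | rewrite expg1n; exact: (sub1 (lcs_subgroup G i.+1))].
- split; first exact: subM.
  apply/pK; rewrite (homX pM) pM expgMn; last exact: pZ.
  by rewrite -!(homX pM) (proj2 (pK _) hu) (proj2 (pK _) hv) mulg1.
- split; first exact: subV.
  by rewrite expVgn; exact: (subV (lcs_subgroup G i.+1)).
Qed.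

Lemma lcs_power_step (G : groupType) m : (forall x y : G, lcs G 2 ([~ x, y] ^+ m)) ->
  forall i u, lcs G i.+1 u -> lcs G i.+2 (u ^+ m).
Proof.
move=> hm i u; suff h : lcs G i.+1 `<=` [set u | lcs G i.+1 u /\ lcs G i.+2 (u ^+ m)].
  by case/h.
elim: i {u} => [|i IH]; apply: commset_ind; try exact: lcs_power_subgroup.
  by move=> x y _ _; split; [exact: lcs_comm | exact: hm].
move=> u g /IH[Gu Gum] _; split; first exact: lcs_comm.
have [Q [p [pM _ pK pZ]]] := lcs_quotient G i.+2.
apply/pK; rewrite (homX pM) (homR pM) -commXg_central -?(homX pM) -(homR pM).
  by apply/pK; apply: lcs_comm.
by apply: pZ; apply: lcs_comm.
Qed.

(** If the first factor of the lower central series has exponent [m], so have all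
    the later ones, because commutation with a fixed element is a homomorphism
    from each factor to the next. *)
Lemma lcs_power (G : groupType) m c : (forall x y : G, lcs G 2 ([~ x, y] ^+ m)) ->
  lcs G c `<=` [set 1] -> forall u, lcs G 1 u -> u ^+ (m ^ c) = 1.
Proof.
move=> hm nG u Gu; apply: nG.
have : lcs G c.+1 (u ^+ (m ^ c)).
  elim: c => [|c IH]; first by rewrite expn0 expg1.
  by rewrite expnSr expgnA; apply: lcs_power_step.
exact: lcs_le.
Qed.

Section Frattini.
Variables (H : groupType) (A B : set H) (m c e : nat).
Hypotheses (sA : is_subgroup A) (sB : is_subgroup B).
Hypotheses (nA : normal_set A) (nB : normal_set B) (AB : A `<=` B).
Hypothesis comm_AA : forall a b, A a -> B b -> commset A A [~ a, b].
Hypothesis frat : forall a, A a ->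
  exists y u, [/\ B y, commset B B u & a = y ^+ m * u].
Hypothesis nH : lcs H c `<=` [set 1].
Hypothesis tH : forall u, lcs H 1 u -> u ^+ (m ^ e) = 1.

Let X := commset A B.
Let X1 := commset X B.
Let sX : is_subgroup X := commset_subgroup A B.

Let XA : X `<=` A.
Proof.
apply: commset_ind => // a b Aa Bb; rewrite commgEl.
by apply: subM => //; [apply: subV | apply: nA].
Qed.

(** Let [X = [A, B]] and [X1 = [X, B]].  Modulo [X1], commutation with [a] in [A]
    is a homomorphism from [B] to the central subgroup [X / X1], so by [frat] it
    maps [A] to [m]-th powers.  As [X] is generated by commutators of elements of
    [A], every element of [X / X1] is an [m]-th power; but its exponent divides a
    power of [m], so [X = X1], and then [X] is trivial because [H] is nilpotent. *)
Lemma frattini_central a b : A a -> B b -> [~ a, b] = 1.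
Proof.
have nX : normal_set X.
  by move=> x y; apply: commset_normal => z; [apply: nA | apply: nB].
have nX1 : normal_set X1.
  by move=> x y; apply: commset_normal => z; [apply: nX | apply: nB].
have [Q [p [pM _ pK]]] := quotient_hom (commset_subgroup X B) nX1.
have pXB x y : X x -> B y -> commute (p x) (p y).
  by move=> Xx By; apply/commg_eq1; rewrite -(homR pM); apply/pK; apply: mem_commset.
have bil a' x y : A a' -> B x -> B y -> p [~ a', x * y] = p [~ a', x] * p [~ a', y].
  move=> Aa Bx By; have Xx := mem_commset Aa Bx; have Xy := mem_commset Aa By.
  rewrite commgMr pM (homJ pM) (commute_conj (pXB _ _ Xx By)).
  by apply: pXB => //; apply/AB/XA.
have bil1 a' : p [~ a', 1] = 1 by rewrite commg1 (hom1 pM).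
have bilX a' x n : A a' -> B x -> p [~ a', x ^+ n] = p [~ a', x] ^+ n.
  move=> Aa Bx; elim: n => [|n IH]; first exact: bil1.
  by rewrite !expgS bil ?IH //; apply: subX.
have bilR a' u : A a' -> commset B B u -> B u /\ p [~ a', u] = 1.
  move=> Aa; move: u; apply: (@commset_ind _ _ _ [set u | B u /\ p [~ a', u] = 1]).
    split=> [|u v [Bu hu] [Bv hv]|u [Bu hu]] /=.
    - by split; [apply: sub1 | apply: bil1].
    - by split; [apply: subM | rewrite bil // hu hv mulg1].
    - split; first exact: subV.
      apply: (mulgI (p [~ a', u])); rewrite -bil //; last exact: subV.
      by rewrite mulgV bil1 hu mulg1.
  move=> x y Bx By; split; first exact: subR.
  have Byx := subM sB By Bx; have Bxy := subR sB Bx By.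
  have := bil _ _ _ Aa Bx By; rewrite commgC (bil _ _ _ Aa Byx Bxy).
  rewrite (bil _ _ _ Aa By Bx) => h; apply: (mulgI (p [~ a', y] * p [~ a', x])).
  by rewrite h mulg1; apply: pXB; [exact: mem_commset | exact: (AB (XA (mem_commset Aa By)))].
have rootX w : X w -> exists2 v, X v & p w = p v ^+ m.
  have sX2 : is_subgroup [set w | exists2 v, X v & p w = p v ^+ m].
    split=> [|x y [v Xv hv] [v' Xv' hv']|x [v Xv hv]] /=.
    - by exists 1; [exact: (sub1 sX) | rewrite (hom1 pM) expg1n].
    - exists (v * v'); first exact: (subM sX Xv Xv').
      rewrite pM hv hv' pM expgMn //; apply: pXB => //; exact/AB/XA.
    - exists v^-1; first exact: (subV sX Xv).
      by rewrite (homV pM) hv (homV pM) expVgn.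
  move: w; apply: (commset_ind sX2) => a' b' Aa' Bb'.
  move: (comm_AA Aa' Bb'); move: ([~ a', b']) => w {Bb'}.
  move: w; apply: (commset_ind sX2) => x y Ax /frat[z [u [Bz BBu ->]]].
  have [Bu hu] := bilR _ _ Ax BBu.
  exists [~ x, z]; first exact: mem_commset.
  by rewrite bil //; [rewrite hu mulg1 bilX | apply: subX].
have rootXn n w : X w -> exists2 v, X v & p w = p v ^+ (m ^ n).
  elim: n w => [|n IH] w Xw; first by exists w.
  have [v Xv ->] := rootX _ Xw; have [v' Xv' ->] := IH _ Xv; exists v' => //.
  by rewrite -expgnA expnSr.
have XX1 : X `<=` X1.
  move=> w /(rootXn e)[v Xv h]; apply/pK; rewrite h -(homX pM) tH ?(hom1 pM) //.
  move: v Xv {h}; apply: commset_ind => [|x y _ _]; first exact: lcs_subgroup.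
  exact: lcs_comm.
have Xlcs n : X `<=` lcs H n.
  elim: n => [|n IH] // w /XX1; apply: commset_ind w => [|x y /IH Hx _].
    exact: commset_subgroup.
  exact: lcs_comm.
by move=> Aa Bb; apply: nH; apply: (Xlcs c); apply: mem_commset.
Qed.

End Frattini.

(** * The first two factors of the lower central series *)

Section AbelianSection.
Variables (G : groupType) (H L : set G) (V : zmodType) (p : G -> V).
Hypotheses (sH : is_subgroup H) (sL : is_subgroup L) (LH : L `<=` H).
Hypothesis pM : forall x y, H x -> H y -> p (x * y) = (p x + p y)%R.
Hypothesis pS : forall v, exists2 x, H x & p x = v.
Hypothesis pK : forall x, H x -> (p x = 0%R <-> L x).

Lemma sect1 : p 1 = 0%R.
Proof. by apply/pK; apply: sub1. Qed.

Lemma sectV x : H x -> p x^-1 = (- p x)%R.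
Proof.
move=> Hx; apply: (@GRing.addrI _ (p x)); rewrite -pM //; last exact: subV.
by rewrite mulgV sect1 GRing.subrr.
Qed.

Lemma sectX x n : H x -> p (x ^+ n) = (p x *+ n)%R.
Proof.
move=> Hx; elim: n => [|n IH]; first exact: sect1.
by rewrite expgS GRing.mulrS -IH pM //; apply: subX.
Qed.

Lemma sect_cong x y : H x -> H y -> (p x = p y <-> L (x^-1 * y)).
Proof.
move=> Hx Hy; rewrite -pK; last by apply: subM => //; apply: subV.
rewrite pM ?sectV //; last exact: subV.
split=> [->|h]; first by rewrite GRing.addNr.
by apply: (@GRing.addrI _ (- p x)%R); rewrite h GRing.addNr.
Qed.

Lemma sect_gen n (y : 'I_n -> G) : (forall i, H (y i)) ->
  (forall K, is_subgroup K -> L `<=` K -> (forall i, K (y i)) -> H `<=` K) ->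
  forall v, exists a, v = comb (p \o y) a.
Proof.
move=> Hy gy v; have [x Hx <-] := pS v.
suff: H `<=` [set g | H g /\ exists a, p g = comb (p \o y) a] by move=> h; have [] := h x Hx.
have comb0 : comb (p \o y) 0%R = 0%R.
  by rewrite /comb big1 // => i _; rewrite mxE mulr0z.
apply: gy => [|g Lg|i].
- split=> [|g h [Hg [a ga]] [Hh [b hb]]|g [Hg [a ga]]].
  + by split; [apply: sub1 | exists 0%R; rewrite sect1 comb0].
  + split; first exact: subM.
    exists (a - (0 - b))%R; rewrite pM // ga hb !combB comb0.
    by rewrite GRing.sub0r GRing.opprK.
  + split; first exact: subV.
    by exists (0 - a)%R; rewrite sectV // ga combB comb0 GRing.sub0r.
- by split; [apply: LH | exists 0%R; rewrite comb0; apply/pK => //; apply: LH].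
- split=> //; exists (delta_mx 0 i)%R.
  rewrite /comb (bigD1 i) //= big1 => [|j ji]; last first.
    by rewrite !mxE (negbTE ji) andbF mulr0z.
  by rewrite !mxE !eqxx GRing.addr0.
Qed.

Lemma sect_tors x : H x ->
  tors [set (0 : V)%R] (p x) <-> exists2 m, (0 < m)%N & L (x ^+ m).
Proof.
by move=> Hx; split=> -[m m0 h]; exists m => //; move: h; rewrite /= -sectX // pK //; apply: subX.
Qed.

End AbelianSection.

Lemma comb_fin (V : zmodType) (I : finType) (y : I -> V) (c : I -> int) :
  (\sum_i y i *~ c i)%R = comb (y \o @enum_val I I) (\row_i c (enum_val i))%R.
Proof.
rewrite /comb (reindex (@enum_val I I)) /=.
  by apply: eq_bigr => i _; rewrite mxE.
by exists enum_rank => i _; [exact: enum_valK | exact: enum_rankK].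
Qed.

Section FG.
Variables (G : groupType) (d : nat) (x : 'I_d -> G).
Hypothesis gx : generates x.

Definition ab_tors : set G := [set y | exists2 m, (0 < m)%N & lcs G 1 (y ^+ m)].

Lemma abelianization : exists (V : zmodType) (p : G -> V),
  [/\ forall x y, p (x * y) = (p x + p y)%R, forall v, exists x, p x = v,
      forall x, p x = 0%R <-> lcs G 1 x, forall y z, p y = p z <-> lcs G 1 (y^-1 * z)
    & forall v, exists a, v = comb (p \o x) a].
Proof.
have [|V [p [pM pS pK]]] := abelian_section (setT_subgroup G) (lcs_subgroup G 1) (fun _ _ => I).
  by move=> a b _ _; apply: (lcs_comm (n := 0)).
exists V, p; split.
- by move=> a b; exact: (pM _ _ I I).
- by move=> v; have [g _ <-] := pS v; exists g.
- by move=> g; exact: (pK _ I).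
- by move=> y z; exact: (sect_cong (setT_subgroup G) (lcs_subgroup G 1) pM pK I I).
- apply: (sect_gen (setT_subgroup G) (lcs_subgroup G 1)) => // K sK _ Kx g _.
  exact: gx.
Qed.

Lemma ab_torsP (V : zmodType) (p : G -> V) : (forall x y, p (x * y) = (p x + p y)%R) ->
  (forall x, p x = 0%R <-> lcs G 1 x) -> forall y, ab_tors y <-> tors [set 0%R] (p y).
Proof.
move=> pM pK y; rewrite (sect_tors (setT_subgroup G) (lcs_subgroup G 1) (p := p)) //.
Qed.

Lemma ab_tors_subgroup : is_subgroup ab_tors.
Proof.
have [V [p [pM _ pK _ _]]] := abelianization.
have hp := ab_torsP pM pK.
have pV y : p y^-1 = (- p y)%R.
  by apply: (sectV (setT_subgroup G) (lcs_subgroup G 1)).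
split=> [|y z /hp ty /hp tz|y /hp ty].
- by exists 1%N => //; rewrite expg1; exact: (sub1 (lcs_subgroup G 1)).
- by apply/hp; rewrite pM; apply: (torsD (zero_sub0 V) (@zero_subB V)).
- by apply/hp; rewrite pV; apply: (torsN (zero_sub0 V) (@zero_subB V)).
Qed.

Lemma ab_tors_exponent : exists2 t, (0 < t)%N & forall y, ab_tors y -> lcs G 1 (y ^+ t).
Proof.
have [V [p [pM _ pK _ gp]]] := abelianization.
have [t t0 ht] := tors_exponent (zero_sub0 V) (@zero_subB V) gp.
exists t => // y /(ab_torsP pM pK) /ht /=.
by rewrite -(sectX (setT_subgroup G) (lcs_subgroup G 1) (p:=p)) // => /pK.
Qed.

Lemma ab_tors_classes : exists (F : finType) (col : G -> F),
  forall y z, ab_tors y -> ab_tors z -> col y = col z -> lcs G 1 (y^-1 * z).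
Proof.
have [V [p [pM _ pK pC gp]]] := abelianization.
have [F [col hc]] := tors_classes (zero_sub0 V) (@zero_subB V) gp.
exists F, (col \o p) => y z /(ab_torsP pM pK) ty /(ab_torsP pM pK) tz /= e.
by apply/pC/eqP; rewrite -GRing.subr_eq0; apply/eqP; apply: hc.
Qed.

(** Modulo [lcs G 1] these are the [m]-th powers, which have finite index in a
    finitely generated abelian group: relative to the subgroup of [m]-th powers
    everything is torsion, and there are finitely many torsion classes. *)
Lemma power_index m : (0 < m)%N ->
  let S := [set g | exists y u, lcs G 1 u /\ g = y ^+ m * u] in
  is_subgroup S /\ exists n, index_le setT S n.
Proof.
move=> m0 S; have [V [p [pM pS pK pC gp]]] := abelianization.
have pX n y : p (y ^+ n) = (p y *+ n)%R.
  by apply: (sectX (setT_subgroup G) (lcs_subgroup G 1)).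
have pV y : p y^-1 = (- p y)%R.
  by apply: (sectV (setT_subgroup G) (lcs_subgroup G 1)).
pose R : set V := [set v | exists w, v = (w *+ m)%R].
have SE g : S g <-> R (p g).
  split=> [[y [u [Du ->]]]|[v]].
    by exists (p y); rewrite pM pX (proj2 (pK u) Du) GRing.addr0.
  have [y <-] := pS v; rewrite -pX => h; exists y, (y ^- m * g).
  split; last by rewrite mulVKg.
  by apply/pC; rewrite h.
have R0 : R 0%R by exists 0%R; rewrite GRing.mul0rn.
have RB u v : R u -> R v -> R (u - v)%R.
  by move=> [a ->] [b ->]; exists (a - b)%R; rewrite GRing.mulrnBl.
split.
  split=> [|y z /SE Ry /SE Rz|y /SE Ry]; apply/SE.
  - by rewrite (proj2 (pK 1)) //; exact: (sub1 (lcs_subgroup G 1)).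
  - by rewrite pM -[p z]GRing.opprK; apply: (RB) => //; rewrite -GRing.sub0r; apply: RB.
  - by rewrite pV -GRing.sub0r; apply: RB.
have [F [col hc]] := tors_classes R0 RB gp.
have allt v : tors R v by exists m => //; exists v.
exists #|F|; apply: (color_index (col := col \o p)) => y z _ _ e.
apply/SE; rewrite pM pV GRing.addrC; exact: hc.
Qed.

(** Modulo [lcs G 2] commutators are bimultiplicative. *)
Lemma lcs1_generated K : is_subgroup K -> lcs G 2 `<=` K ->
  (forall i j, K [~ x i, x j]) -> lcs G 1 `<=` K.
Proof.
move=> sK DK Kx; apply: commset_ind => // g h _ _.
have KJ a b c : K [~ a, b] -> K ([~ a, b] ^ c).
  move=> Kab; rewrite -[_ ^ c](mulVKg [~ a, b]) -commgEl; apply: subM => //.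
  by apply: DK; apply: lcs_comm; apply: (lcs_comm (n := 0)).
have right a : (forall j, K [~ a, x j]) -> forall h, K [~ a, h].
  move=> ha; apply: (gx (K := [set h | K [~ a, h]])) => //.
  split=> [|b c Kb Kc|b Kb] /=; first by rewrite commg1; apply: sub1.
    by rewrite commgMr; apply: subM => //; apply: KJ.
  by rewrite commgVr; apply: subV => //; apply: KJ.
move: g; apply: (gx (K := [set g | K [~ g, h]])) => [|i]; last exact: right.
split=> [|b c Kb Kc|b Kb] /=; first by rewrite comm1g; apply: sub1.
  by rewrite commgMl; apply: subM => //; apply: KJ.
by rewrite commgVl; apply: subV => //; apply: KJ.
Qed.

Lemma lcs1_section : exists (n : nat) (y : 'I_n -> G) (U : zmodType) (q : G -> U),
  [/\ forall g h, lcs G 1 g -> lcs G 1 h -> q (g * h) = (q g + q h)%R,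
      forall v, exists2 g, lcs G 1 g & q g = v,
      forall g, lcs G 1 g -> (q g = 0%R <-> lcs G 2 g)
    & forall v, exists a, v = comb (q \o y) a].
Proof.
have [|U [q [qM qS qK]]] := abelian_section (lcs_subgroup G 1) (lcs_subgroup G 2)
    (lcs_le (leqnSn 1)).
  by move=> a b Da _; apply: lcs_comm.
pose I := ('I_d * 'I_d)%type.
exists #|{: I}|, (fun k => let ij : I := enum_val k in [~ x ij.1, x ij.2]), U, q; split=> //.
apply: (sect_gen (lcs_subgroup G 1) (lcs_subgroup G 2)) => //.
- exact: (lcs_le (leqnSn 1)).
- by move=> i; apply: (lcs_comm (n := 0)).
- move=> K sK DK Kx; apply: lcs1_generated => // i j.
  by have := Kx (enum_rank ((i, j) : I)); rewrite enum_rankK.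
Qed.

Lemma lcs1_tors_exponent : exists2 t, (0 < t)%N &
  forall u m, lcs G 1 u -> (0 < m)%N -> lcs G 2 (u ^+ m) -> lcs G 2 (u ^+ t).
Proof.
have [n [y [U [q [qM qS qK gq]]]]] := lcs1_section.
have [t t0 ht] := tors_exponent (zero_sub0 U) (@zero_subB U) gq.
exists t => // u m Du m0 Dm; apply/qK; first exact: (subX (lcs_subgroup G 1)).
rewrite (sectX (lcs_subgroup G 1) (lcs_subgroup G 2)) //; apply: ht.
by apply/(sect_tors (lcs_subgroup G 1) (lcs_subgroup G 2)) => //; exists m.
Qed.

(** A tuple [t] of elements of the finitely generated abelian group
    [U = lcs G 1 / lcs G 2] describes a homomorphism from [G] to [U] by its values
    at the generators.  Those given by commutation with an element [h] form a
    subgroup of [U ^ d], and the quotient of [U ^ d] by it has torsion of bounded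
    exponent. *)
Lemma ad_exponent : exists2 b, (0 < b)%N & forall (t : 'I_d -> G) s h,
  (forall i, lcs G 1 (t i)) -> (0 < s)%N -> (forall i, lcs G 2 ((t i ^+ s)^-1 * [~ x i, h])) ->
  exists h', forall i, lcs G 2 ((t i ^+ b)^-1 * [~ x i, h']).
Proof.
have [n [y [U [q [qM qS qK gq]]]]] := lcs1_section.
have s1 := lcs_subgroup G 1; have s2 := lcs_subgroup G 2.
have D1R a b : lcs G 1 [~ a, b] by apply: (lcs_comm (n := 0)).
pose W : zmodType := {ffun 'I_d -> U}.
pose R : set W := [set w | exists h, forall i, w i = q [~ x i, h]].
have qR i a b : q [~ x i, a * b] = (q [~ x i, a] + q [~ x i, b])%R.
  rewrite commgMr qM //; last by apply: lcs_normal.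
  rewrite GRing.addrC; congr (_ + _)%R.
  apply/(sect_cong s1 s2) => //; first exact: lcs_normal.
  by apply: (lcong_sym s2); rewrite -commgEl; apply: lcs_comm.
have R0 : R 0%R.
  by exists 1 => i; rewrite ffunE commg1 (sect1 s1 s2 qK).
have RB u v : R u -> R v -> R (u - v)%R.
  move=> [a ha] [b hb]; exists (a * b^-1) => i.
  rewrite !ffunE ha hb qR; congr (_ + _)%R.
  apply: (@GRing.addrI _ (q [~ x i, b])); rewrite GRing.subrr -qR mulgV commg1.
  by rewrite (sect1 s1 s2 qK).
pose I : finType := ('I_d * 'I_n)%type.
pose Y (k : I) : W := [ffun i => if i == k.1 then q (y k.2) else 0%R].
have gW (v : W) : exists a, v = comb (Y \o @enum_val I I) a.
  have /boolp.choice[a ha] : forall i, exists a, v i = comb (q \o y) a by move=> i; apply: gq.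
  exists (\row_k a (@enum_val I I k).1 0 (@enum_val I I k).2)%R.
  rewrite -(comb_fin Y (fun k : I => a k.1 0%R k.2)).
  have evz (w : W) (c : int) i : (w *~ c)%R i = (w i *~ c)%R.
    have evn m : (w *+ m)%R i = (w i *+ m)%R.
      by elim: m => [|m IH]; rewrite ?ffunE // !GRing.mulrS ffunE IH.
    case: c => m; first exact: evn.
    by rewrite NegzE !mulrNz ffunE; congr (- _)%R; exact: evn.
  apply/ffunP => i; rewrite sum_ffunE ha /comb.
  rewrite -(pair_bigA _ (fun i' j => (Y (i', j) *~ a i' 0 j)%R i)) /=.
  rewrite (bigD1 i) //= [X in (_ + X)%R]big1 => [|i' ii].
    rewrite GRing.addr0; apply: eq_bigr => j _.
    by rewrite evz ffunE eqxx.
  by apply: big1 => j _; rewrite evz ffunE /= eq_sym (negbTE ii) mul0rz.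
have [b b0 hb] := tors_exponent R0 RB gW.
exists b => // t s h Dt s0 hs.
pose w : W := [ffun i => q (t i)].
have evn (v : W) m i : (v *+ m)%R i = (v i *+ m)%R.
  by elim: m => [|m IH]; rewrite ?ffunE // !GRing.mulrS ffunE IH.
have [|h' hh'] := hb w.
  exists s => //; exists h => i; rewrite evn ffunE -(sectX s1 s2) //.
  by apply/(sect_cong s1 s2) => //; apply: (subX s1).
exists h' => i; apply/(sect_cong s1 s2 qM qK) => //; first exact: (subX s1).
by rewrite (sectX s1 s2) // -hh' evn ffunE.
Qed.
End FG.

(** * The action on the range of an embedding *)

Section OneEmbedding.
Variables (G : groupType) (d : nat) (x : 'I_d -> G) (f : G -> G) (s : nat).
Hypotheses (gx : generates x) (fM : {morph f : x y / x * y}).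
Hypotheses (f_inj : injective f) (nR : normal_set (range f)).
Hypothesis iR : index_le setT (range f) s.

Lemma hom_eq (Q : groupType) (a b : G -> Q) :
  {morph a : x y / x * y} -> {morph b : x y / x * y} ->
  (forall i, a (x i) = b (x i)) -> forall y, a y = b y.
Proof.
move=> aM bM ab y; apply: (gx (K := [set y | a y = b y])) => //.
split=> [|u v uE vE|u uE] /=; first by rewrite (hom1 aM) (hom1 bM).
  by rewrite aM bM uE vE.
by rewrite (homV aM) (homV bM) uE.
Qed.

Lemma range_power g : exists2 n, (0 < n)%N & range f (g ^+ n).
Proof.
have [n n0 h] := index_le_exponent (range_subgroup fM) iR.
by exists n => //; apply: h.
Qed.

(** The embedding [f] induces an endomorphism of the abelianization whose image
    has finite index; so its kernel is torsion. *)
Lemma embedding_tors y : lcs G 1 (f y) -> ab_tors y.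
Proof.
have [V [p [pM pS pK pC gp]]] := abelianization gx.
have [g hg] := boolp.choice pS.
have s1 := lcs_subgroup G 1.
have pV u : p u^-1 = (- p u)%R by apply: (sectV (setT_subgroup G) s1).
have pX n u : p (u ^+ n) = (p u *+ n)%R by apply: (sectX (setT_subgroup G) s1).
pose th v := p (f (g v)).
have thE u : th (p u) = p (f u).
  apply/pC; rewrite -(homV fM) -fM; apply: (lcs_hom fM).
  by apply/pC; rewrite hg.
have thB : {morph th : u v / (u - v)%R}.
  move=> u v; rewrite -(hg u) -(hg v) -pV -pM !thE fM (homV fM) pM pV //.
move=> Dy; apply/(ab_torsP pM pK).
apply: (tors_kernel (zero_sub0 V) (@zero_subB V) gp thB).
- by move=> v ->; have := thB 0%R 0%R; rewrite !GRing.subrr.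
- move=> v; have [n n0 [h _ hE]] := range_power (g v); exists n => //.
  by exists (p h); rewrite /= thE hE pX hg GRing.subrr.
- rewrite thE (proj2 (pK _) Dy); exists 1%N => //=.
Qed.

Lemma conj_lift g : exists a : G -> G, {morph a : x y / x * y} /\
  forall y, f (a y) = f y ^ g.
Proof.
have /boolp.choice[a ha] : forall y, exists z, f z = f y ^ g.
  by move=> y; have [|z _ zE] := nR g (_ : range f (f y)); [exists y | exists z].
by exists a; split=> // u v; apply: f_inj; rewrite fM !ha fM conjMg.
Qed.

(** The elements of [G] that act trivially on the abelianization of the range of
    [f], on which [G] acts by conjugation because the range is normal. *)
Definition ab_central : set G := [set g | forall y, (f @` lcs G 1) [~ f y, g]].

Lemma image_lcs1_normal g u : (f @` lcs G 1) u -> (f @` lcs G 1) (u ^ g).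
Proof.
move=> [v Dv <-]; have [a [aM ha]] := conj_lift g.
by exists (a v); [apply: (lcs_hom aM) | rewrite ha].
Qed.

Lemma ab_central_subgroup : is_subgroup ab_central.
Proof.
have sI := image_subgroup fM (lcs_subgroup G 1).
split=> [y|a b Ka Kb y|a Ka y].
- by rewrite commg1; apply: (sub1 sI).
- by rewrite commgMr; apply: (subM sI) => //; apply: image_lcs1_normal.
- by rewrite commgVr; apply: (subV sI) => //; apply: image_lcs1_normal.
Qed.

Lemma comm_range y g : exists2 t, f t = [~ f y, g] & ab_tors t.
Proof.
have [a [aM ha]] := conj_lift g; exists (y^-1 * a y).
  by rewrite fM (homV fM) ha.
apply: embedding_tors; rewrite fM (homV fM) ha -commgEl.
exact: (lcs_comm (n := 0)).
Qed.

(** For every [g] the commutators [[~ f (x i), g]] come from torsion classes of the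
    abelianization, of which there are finitely many, and these classes determine
    the action of [g].  So the index is bounded independently of [f]. *)
Lemma ab_central_index (F : finType) (col : G -> F) :
  (forall y z, ab_tors y -> ab_tors z -> col y = col z -> lcs G 1 (y^-1 * z)) ->
  index_le setT ab_central #|{: {ffun 'I_d -> F}}|.
Proof.
move=> hcol.
have s1 := lcs_subgroup G 1.
have [Q [p [pM _ pK]]] := quotient_hom s1 (@lcs_normal G 1).
have pC := kernel_cong pM pK.
have /boolp.choice[a ha] := conj_lift.
pose c g := [ffun i => col ((x i)^-1 * a g (x i))] : {ffun 'I_d -> F}.
have ator g y : ab_tors (y^-1 * a g y).
  have [aM haE] := ha g.
  apply: embedding_tors; rewrite fM (homV fM) haE -commgEl.
  exact: (lcs_comm (n := 0)).
apply: (color_index (col := c)) => g h _ _ e y.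
have [agM ag] := ha g; have [ahM ah] := ha h; have [aiM ai] := ha g^-1.
have same z : p (a g z) = p (a h z).
  apply: (@hom_eq Q (p \o a g) (p \o a h)) z => [u v|u v|i] /=.
  - by rewrite agM pM.
  - by rewrite ahM pM.
  - apply/pC; have := congr1 (fun e : {ffun 'I_d -> F} => e i) e.
    rewrite !ffunE => /hcol -/(_ (ator _ _) (ator _ _)).
    by rewrite invgM invgK -mulgA mulVKg.
have yE : a g (a g^-1 y) = y.
  by apply: f_inj; rewrite ag ai -conjgM mulVg conjg1.
exists (y^-1 * a h (a g^-1 y)).
  apply/pK; rewrite pM -same yE -pM mulVg; exact: hom1.
by rewrite fM (homV fM) ah ai -conjgM commgEl.
Qed.

Section ClassTwo.
Variables (b t2 : nat).
Hypothesis b0 : (0 < b)%N.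
Hypothesis hb : forall (t : 'I_d -> G) s h,
  (forall i, lcs G 1 (t i)) -> (0 < s)%N -> (forall i, lcs G 2 ((t i ^+ s)^-1 * [~ x i, h])) ->
  exists h', forall i, lcs G 2 ((t i ^+ b)^-1 * [~ x i, h']).
Hypothesis ht2 : forall u m, lcs G 1 u -> (0 < m)%N -> lcs G 2 (u ^+ m) -> lcs G 2 (u ^+ t2).

(** Let [a] be conjugation by [z] on the range of [f], read as an endomorphism of
    [G].  It moves [y] by an element [t y] of [lcs G 1], and [t] is a homomorphism
    modulo [lcs G 2].  A power of [z] lies in the range, so [t] is torsion modulo
    inner actions; by [hb] its multiple by [b] is the action of some [h'], that
    is, [z ^+ b] and [f h'] act alike on the range modulo [lcs G 2].  So,
    modulo [lcs G 2], the element [w = z ^+ b * (f h')^-1] commutes with the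
    range, and therefore, up to torsion, with every [v]. *)
Lemma class_two_power z v : ab_central z ->
  exists2 r, range f r & lcs G 2 (([~ v, z] ^+ (b * t2))^-1 * r).
Proof.
move=> cz; have [a [aM ha]] := conj_lift z.
have s2 := lcs_subgroup G 2.
have [N [q [qM _ qK qZ]]] := lcs_quotient G 1.
have qC := kernel_cong qM qK.
have lcs1R u w : lcs G 1 [~ u, w] by apply: (lcs_comm (n := 0)).
have /boolp.choice[t ht] : forall y, exists u, lcs G 1 u /\ a y = y * u.
  move=> y; have [u Du uE] := cz y; exists u; split=> //; apply: f_inj.
  by rewrite fM uE ha commgEl mulVKg.
have Dt y : lcs G 1 (t y) by have [] := ht y.
have aE y : a y = y * t y by have [] := ht y.
have tM u w : q (t (u * w)) = q (t u) * q (t w).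
  have e : q (u * w) * q (t (u * w)) = q u * q w * (q (t u) * q (t w)).
    rewrite -qM -aE aM !aE !qM -!mulgA; congr (_ * _).
    by rewrite !mulgA (qZ _ w (Dt u)).
  by apply: (mulgI (q (u * w))); rewrite e qM.
have tD u : lcs G 1 u -> q (t u) = 1.
  suff sub : lcs G 1 `<=` [set u | q (t u) = 1] by exact: sub.
  apply: commset_ind => [|u' w _ _].
    by apply: (preim_subgroup (f := fun y => q (t y)) tM (trivial_subgroup N)).
  by rewrite /= (homR (f := fun y => q (t y)) tM); apply/commg_eq1/qZ.
have iterE n y : q (iter n a y) = q y * q (t y) ^+ n.
  elim: n => [|n IH] /=; first by rewrite mulg1.
  rewrite aE qM IH; have -> : q (t (iter n a y)) = q (t y).
    elim: n {IH} => [|n IH] //=.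
    by rewrite aE tM IH (tD (t _)) ?mulg1.
  by rewrite -mulgA -expgSr.
have fiter n y : f (iter n a y) = f y ^ (z ^+ n).
  elim: n => [|n IH] /=; first by rewrite conjg1.
  by rewrite ha IH -conjgM -expgSr.
have [n n0 [h _ hE]] := range_power z.
have [h' hh'] : exists h', forall i, lcs G 2 ((t (x i) ^+ b)^-1 * [~ x i, h']).
  apply: (hb (s := n) (h := h)) => // i; apply/qC.
  rewrite (homX qM); apply: (mulgI (q (x i))).
  rewrite -iterE -qM; congr q; apply: f_inj.
  by rewrite fiter -hE -(homJ fM) commgEl mulVKg.
have main y : q (iter b a y) = q (y ^ h').
  apply: (@hom_eq N (q \o iter b a) (fun y => q (y ^ h'))) y => [u w|u w|i] /=.
  - by rewrite (iter_hom aM) qM.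
  - by rewrite conjMg qM.
  - rewrite iterE -(homX qM) (proj2 (qC _ _) (hh' i)) -qM.
    by rewrite commgEl mulVKg.
pose w := z ^+ b * (f h')^-1.
have wD y : lcs G 2 [~ f y, w].
  have : lcs G 2 ((y ^ h')^-1 * iter b a y) by apply/qC.
  move=> /(@lcs_normal G 2 _ h'^-1) /(lcs_hom fM).
  rewrite conjMg conjVg -conjgM mulgV conjg1 fM (homV fM).
  by rewrite (homJ fM) fiter (homV fM) -conjgM -commgEl.
have vw : lcs G 2 ([~ v, w] ^+ t2).
  have [m m0 [y _ yE]] := range_power v.
  apply: (ht2 (lcs1R _ _) m0); apply/qK.
  rewrite (homX qM) (homR qM) -commXg_central; last first.
    by rewrite -(homR qM); apply: qZ.
  by rewrite -(homX qM) -(homR qM) -yE; apply/qK.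
exists ([~ v, f h'] ^+ t2).
  apply: (subX (range_subgroup fM)); rewrite -invgR; apply: (subV (range_subgroup fM)).
  by have [u <- _] := comm_range h' v; exists u.
apply/qC; rewrite !(homX qM) expgnA -(homX qM).
have -> : q [~ v, z] ^+ b = q [~ v, z ^+ b].
  rewrite (homR qM) -commgX_central -?(homX qM) -?(homR qM) //; exact: qZ.
have -> : z ^+ b = w * f h' by rewrite /w mulgVK.
rewrite commgMr qM expgMn; last exact: qZ.
rewrite (homJ qM) commute_conj; last exact: qZ.
by rewrite -!(homX qM) (proj2 (qK _) vw) mulg1.
Qed.

End ClassTwo.
End OneEmbedding.

(** * Chains of embeddings *)

Section Chain.
Variables (G : groupType) (d : nat) (x : 'I_d -> G).
Variables (f : nat -> G -> G) (s : nat -> nat).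
Hypotheses (gx : generates x) (fM : forall k, {morph f k : x y / x * y}).
Hypotheses (f_inj : forall k, injective (f k)) (nR : forall k, normal_set (range (f k))).
Hypothesis iR : forall k, index_le setT (range (f k)) (s k).
Hypothesis dR : forall k, range (f k.+1) `<=` range (f k).

Let sR k : is_subgroup (range (f k)) := range_subgroup (fM k).

(** The bound of [ab_central_index] is the same for all members of the chain, so
    one core serves for all of them. *)
Lemma chain_ab_central : exists K n, [/\ is_subgroup K, index_le setT K n
  & forall k, K `<=` ab_central (f k)].
Proof.
have [F [col hcol]] := ab_tors_classes gx.
pose n0 := #|{: {ffun 'I_d -> F}}|.
have [n iK] := core_index gx n0.
exists (core n0), n; split=> [||k g Kg]; [exact: core_subgroup | by [] |].
have iA := ab_central_index gx (fM k) (@f_inj k) (@nR k) (iR k) hcol.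
exact: (Kg _ (ab_central_subgroup (fM k) (@f_inj k) (@nR k)) iA).
Qed.

(** The exponent [m] does not depend on [l]: in all the finite quotients of [G] by
    a member of the chain, the first factor of the lower central series has
    exponent dividing [m]. *)
Lemma chain_class_two : exists2 m, (0 < m)%N &
  forall l u v, exists2 r, range (f l) r & lcs G 2 (([~ u, v] ^+ m)^-1 * r).
Proof.
have [K [n [sK iK Kc]]] := chain_ab_central.
have [e e0 he] := index_le_exponent sK iK.
have [b b0 hb] := ad_exponent gx.
have [t2 t20 ht2] := lcs1_tors_exponent gx.
exists (e * (b * t2))%N; first by rewrite !muln_gt0 e0 b0.
move=> l u v; have cz : ab_central (f l) (v ^+ e) by apply: Kc; apply: he.
have [r Rr hr] := class_two_power gx (fM l) (@f_inj l) (@nR l) (iR l) hb ht2 u cz.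
exists r => //; move: hr.
have [N [q [qM _ qK qZ]]] := lcs_quotient G 1.
have e1 : q [~ u, v ^+ e] = q [~ u, v] ^+ e.
  rewrite !(homR qM) (homX qM) commgX_central // -(homR qM).
  by apply: qZ; apply: (lcs_comm (n := 0)).
rewrite -!qK !qM !(homV qM) (expgnA _ e) !(homX qM (b * t2)) e1.
by rewrite (homX qM e).
Qed.

(** Choose [k0] such that, modulo every [range (f l)], each element of
    [range (f k0)] agrees with one that acts trivially on the abelianizations of
    all members of the chain; and then [k1] such that, modulo every
    [range (f l)], each element of [range (f k1)] is an [m]-th power in the
    abelianization of [range (f k0)].  Then the images of both in
    [G / range (f l)] satisfy the hypotheses of [frattini_central]. *)
Lemma chain_commute : exists k0 k1, (k0 <= k1)%N /\
  forall l a b, range (f k1) a -> range (f k0) b -> range (f l) [~ a, b].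
Proof.
have [K [n [sK iK Kc]]] := chain_ab_central.
have [m m0 hm] := chain_class_two.
have [k0 hk0] := decreasing_stab sK iK (L := fun k => range (f k)) dR.
have [sS [nS iS]] := power_index gx m0.
set S := [set g | _] in sS iS.
have sS' := image_subgroup (fM k0) sS.
have iS' : index_le setT (f k0 @` S) (s k0 * nS).
  by apply: (index_leM (sR k0) (iR k0)); apply: index_le_image.
have [k2 hk2] := decreasing_stab sS' iS' (L := fun k => range (f k)) dR.
exists k0, (maxn k0 k2); split; first exact: leq_maxl.
set k := maxn k0 k2 => l a b Ra Rb.
have [N [q [qM qS qK]]] := quotient_hom (sR l) (@nR l).
have [c hc] := normal_embedding_nilpotent gx (fM l) (@f_inj l) (@nR l) (iR l).
have nN : lcs N c `<=` [set 1].
  by move=> y /(lcs_surj qM qS)[u /hc Ru <-]; apply/qK.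
have pN (u v : N) : lcs N 2 ([~ u, v] ^+ m).
  have [g <-] := qS u; have [h <-] := qS v; have [r Rr hr] := hm l g h.
  have := lcs_hom qM hr; rewrite qM (homV qM) (proj2 (qK r) Rr) mulg1.
  by move=> /(subV (lcs_subgroup N 2)); rewrite invgK (homX qM) (homR qM).
have tN := lcs_power pN nN.
pose A := q @` range (f k); pose B := q @` range (f k0).
have imN k' : normal_set (q @` range (f k')).
  move=> _ y [u Ru <-]; have [g <-] := qS y; exists (u ^ g); first exact: nR.
  by rewrite (homJ qM).
apply/qK; rewrite (homR qM).
apply: (@frattini_central N A B m c c).
- exact: (image_subgroup qM).
- exact: (image_subgroup qM).
- exact: imN.
- exact: imN.
- move=> _ [u Ru <-]; exists u => //; exact: (decreasing_le (L := fun k => range (f k)) dR (leq_maxl _ _) Ru).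
- move=> _ _ [u [y _ <-] <-] [v Rv <-].
  have [w Rw Kw] := hk0 k0 l v (leqnn _) Rv.
  have [t Dt tE] := Kc k _ Kw y.
  have -> : q v = q (w^-1 * v) by rewrite qM (homV qM) (proj2 (qK w) Rw) invg1 mul1g.
  rewrite -(homR qM) -tE.
  move: t Dt {tE}; apply: (commset_hom (f := q \o f k)) => [u' v'|u' _|u' _] /=.
  + by rewrite (fM k) qM.
  + by exists (f k u') => //; exists u'.
  + by exists (f k u') => //; exists u'.
- move=> _ [u Ru <-].
  have [w Rw [g [y [v [Dv ->]]] gE]] := hk2 k l u (leq_maxr _ _) Ru.
  exists (q (f k0 y)), (q (f k0 v)); split.
  + by exists (f k0 y) => //; exists y.
  + move: v Dv {gE}; apply: (commset_hom (f := q \o f k0)) => [u' v'|u' _|u' _] /=.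
    * by rewrite (fM k0) qM.
    * by exists (f k0 u') => //; exists u'.
    * by exists (f k0 u') => //; exists u'.
  + rewrite -(homX qM) -qM -(homX (fM k0)) -(fM k0) gE qM (homV qM).
    by rewrite (proj2 (qK w) Rw) invg1 mul1g.
- exact: nN.
- exact: tN.
- by exists a.
- by exists b.
Qed.

End Chain.

(** * The quotient by the intersection of a chain *)

Section ChainQuotient.
Variables (G : groupType) (d : nat) (x : 'I_d -> G).
Variables (f : nat -> G -> G) (s : nat -> nat).
Hypotheses (gx : generates x) (fM : forall k, {morph f k : x y / x * y}).
Hypotheses (f_inj : forall k, injective (f k)) (nR : forall k, normal_set (range (f k))).
Hypothesis iR : forall k, index_le setT (range (f k)) (s k).
Hypothesis dR : forall k, range (f k.+1) `<=` range (f k).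
Variables (Q : groupType) (p : G -> Q).
Hypotheses (pM : {morph p : x y / x * y}) (pS : forall y, exists x, p x = y).
Hypothesis pK : forall y, p y = 1 <-> forall k, range (f k) y.

Let sR k : is_subgroup (range (f k)) := range_subgroup (fM k).

Let pC u v : p u = p v -> p (u^-1 * v) = 1.
Proof. by move=> h; rewrite pM (homV pM) h mulVg. Qed.

(** With [k] the larger of the two indices of [chain_commute], the image [Q_k] of
    [range (f k)] in [Q] is abelian of finite index, and the commutators [[Q_k, Q]]
    are images of torsion classes of an abelianization, so there are finitely many
    of them.  Some member of the chain avoids the nontrivial ones; since the
    quotients by members of the chain are nilpotent, so is [Q].  The commutators
    of [Q] are torsion modulo [[Q_k, Q]], and it follows that [lcs Q 1] has
    finite exponent. *)
Lemma chain_quotient : nilpotent Q /\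
  exists2 m, (0 < m)%N & forall u, lcs Q 1 u -> u ^+ m = 1.
Proof.
have [k0 [k [k01 comm]]] := chain_commute gx fM f_inj nR iR dR.
have fkD u : lcs G 1 u -> p (f k u) = 1.
  suff sub : lcs G 1 `<=` [set u | p (f k u) = 1] by exact: sub.
  apply: commset_ind => [|a b _ _].
    apply: (preim_subgroup (f := p \o f k) _ (trivial_subgroup Q)).
    by move=> a b /=; rewrite (fM k) pM.
  apply/pK => l; rewrite (homR (fM k)); apply: comm; first by exists a.
  by apply: (decreasing_le (L := fun k => range (f k)) dR k01); exists b.
have [F [col hcol]] := ab_tors_classes gx.
have pcol t t' : ab_tors t -> ab_tors t' -> col t = col t' -> p (f k t) = p (f k t').
  move=> ht ht' /(hcol _ _ ht ht') /fkD; rewrite (fM k) (homV (fM k)) pM (homV pM) => h.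
  by apply: (mulgI (p (f k t))^-1); rewrite h mulVg.
have [l0 hl0] : exists l0, forall t, ab_tors t -> range (f l0) (f k t) -> p (f k t) = 1.
  have /boolp.choice[L hL] : forall c, exists l, forall t, ab_tors t -> col t = c ->
      p (f k t) <> 1 -> ~ range (f l) (f k t).
    move=> c; have [[t [ht tc nt]]|no] := pselect (exists t, [/\ ab_tors t, col t = c & p (f k t) <> 1]).
      have [l nl] : exists l, ~ range (f l) (f k t).
        by apply: contra_notP nt => /forallNP h; apply/pK => l; apply: contrapT.
      exists l => t' ht' t'c _ Rt'; apply: nl.
      have e : p (f k t') = p (f k t) by apply: pcol; rewrite // t'c.
      have /pC/pK/(_ l) h := e; exact: (subMl (sR l) (subV (sR l) Rt') h).
    by exists 0%N => t ht tc nt; case: no; exists t.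
  exists (\max_c L c)%N => t ht Rt; apply: contrapT => nt.
  apply: (hL (col t) t ht erefl nt); exact: (decreasing_le (L := fun k => range (f k)) dR (leq_bigmax (col t)) Rt).
have tsub := ab_tors_subgroup gx.
have [c1 hc1] := normal_embedding_nilpotent gx (fM k) (@f_inj k) (@nR k) (iR k).
have [c2 hc2] := normal_embedding_nilpotent gx (fM l0) (@f_inj l0) (@nR l0) (iR l0).
have step u : lcs G c1.+1 u -> exists2 t, ab_tors t & p (f k t) = p u.
  move: u; apply: (commset_ind (K := [set u | exists2 t, ab_tors t & p (f k t) = p u])).
    split=> [|u v [t ht tE] [t' ht' tE']|u [t ht tE]] /=.
    - by exists 1; [exact: sub1 | rewrite (hom1 (fM k))].
    - by exists (t * t'); [exact: subM | rewrite (fM k) !pM tE tE'].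
    - by exists t^-1; [exact: subV | rewrite (homV (fM k)) !(homV pM) tE].
  move=> a b /hc1[y _ <-] _.
  by have [t tE ht] := comm_range gx (fM k) (@f_inj k) (@nR k) (iR k) y b; exists t; rewrite // tE.
pose c := maxn c1.+1 c2.
have nQ : lcs Q c `<=` [set 1].
  move=> y /(lcs_surj pM pS)[u Gu <-].
  have [t ht tE] := step u (lcs_le (leq_maxl _ _) Gu).
  rewrite /= -tE; apply: hl0 => //.
  have Ru := hc2 _ (lcs_le (leq_maxr _ _) Gu).
  have /pC/pK/(_ l0) h := esym tE; exact: (subMl (sR l0) (subV (sR l0) Ru) h).
split.
  exists c; apply/seteqP; split=> // _ ->; exact: (sub1 (lcs_subgroup Q c)).
have [n n0 hn] := index_le_exponent (sR k) (iR k).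
have [t1 t10 ht1] := ab_tors_exponent gx.
exists ((n * t1) ^ c)%N; first by rewrite expn_gt0 muln_gt0 n0 t10.
apply: lcs_power nQ => u v.
have [g <-] := pS u; have [h <-] := pS v.
have [N [q [qM _ qK qZ]]] := lcs_quotient Q 1.
apply/qK; rewrite (homX qM) expgnA.
have -> : q [~ p g, p h] ^+ n = q [~ p g, p h ^+ n].
  rewrite !(homR qM) (homX qM) commgX_central // -(homR qM).
  by apply: qZ; apply: (lcs_comm (n := 0)).
rewrite -(homX pM) -(homR pM); have [y _ <-] := hn h.
have [t tE ht] := comm_range gx (fM k) (@f_inj k) (@nR k) (iR k) y g.
rewrite -invgR (homV pM) -tE -(homX qM) -(homV pM) -(homX pM) -(homV (fM k)) -(homX (fM k)).
rewrite fkD ?(hom1 qM) // expVgn; apply: (subV (lcs_subgroup G 1)); exact: ht1.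
Qed.

End ChainQuotient.

Lemma torsion_free_free_abelian (W : groupType) d (x : 'I_d -> W) :
  generates x -> (forall a b : W, a * b = b * a) ->
  (forall a n, (0 < n)%N -> a ^+ n = 1 :> W -> a = 1) -> free_abelian W.
Proof.
move=> gx WC tf.
have [V [i [j [iM ij ji]]]] := abelian_zmod WC.
have i1 : i 1 = 0%R by apply: (@GRing.addrI _ (i 1)); rewrite -iM mulg1 GRing.addr0.
have iX a n : i (a ^+ n) = (i a *+ n)%R.
  by elim: n => [|n IH]; [exact: i1 | rewrite expgS iM IH GRing.mulrS].
have s1 : is_subgroup [set (1 : W)] by exact: trivial_subgroup.
have gV : forall v, exists a, v = comb (i \o x) a.
  apply: (sect_gen (p := i) (setT_subgroup W) s1) => //.
  - by move=> v; exists (j v).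
  - by move=> a _; rewrite -i1; split=> [/(can_inj ij)|->].
  - by move=> K sK _ Kx a _; apply: gx.
have tV (v : V) : tors [set 0%R] v -> v = 0%R.
  move=> [m m0 /=]; rewrite -{1}(ji v) -iX -i1 => /(can_inj ij) /(tf _ _ m0) h.
  by rewrite -(ji v) h.
have [r [S [gS fS]]] := tors_generators_free (zero_sub0 V) (@zero_subB V) (generators_tors (zero_sub0 V) gV).
have /boolp.choice[a ha] : forall v, exists a, v = comb S a.
  move=> v; have [a ta] := gS v; exists a; apply/eqP.
  by rewrite -GRing.subr_eq0; apply/eqP/tV.
have combI b c : comb S b = comb S c -> b = c.
  move=> e; apply/eqP; rewrite -GRing.subr_eq0; apply/eqP/fS.
  by rewrite combB e GRing.subrr; apply: tors_sub.
have combD b c : comb S (b + c)%R = (comb S b + comb S c)%R.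
  by rewrite /comb -big_split; apply: eq_bigr => l _; rewrite mxE mulrzDr.
have aD u v : a (u + v)%R = (a u + a v)%R.
  by apply: combI; rewrite combD -!ha.
pose F (w : W) : {freeg 'I_r / int} := (\sum_l << a (i w) 0 l *g l >>)%R.
have FM : {morph (F : W -> Algebra.to_multiplicative {freeg 'I_r / int}) : u v / u * v}.
  move=> u v; rewrite /F iM aD; rewrite -[RHS]/(_ + _)%R -big_split.
  by apply: eq_bigr => l _; rewrite mxE -freegUD.
exists 'I_r.
pose FF : {multiplicative W -> Algebra.to_multiplicative {freeg 'I_r / int}} :=
  HB.pack (F : W -> Algebra.to_multiplicative {freeg 'I_r / int}) (isMultiplicative.Build _ _ _ FM).
exists FF; rewrite /FF /=.
have cF w l : coeff l (F w) = a (i w) 0%R l.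
  rewrite /F GRing.raddf_sum (bigD1 l) //= big1 => [|l' ll]; rewrite coeffU.
    by rewrite eqxx GRing.mulr1 GRing.addr0.
  by rewrite (negbTE ll) GRing.mulr0.
exists (fun D => j (comb S (\row_l coeff l D)%R)).
- move=> w /=; rewrite -[RHS]ij [in RHS](ha (i w)); congr (j (comb S _)).
  by apply/rowP => l; rewrite mxE cF.
- move=> D /=; apply/eqP/freeg_eqP => l; rewrite cF ji.
  rewrite (_ : a _ = \row_l coeff l D)%R ?mxE //.
  by apply: combI; rewrite -ha.
Qed.

(** * The torsion subgroup and the theorem *)

Lemma isomorphic_embedding (G : groupType) (H : subgroup G) :
  isomorphic (subgroup_type H) G -> exists f : G -> G,
    [/\ {morph f : x y / x * y}, injective f & range f = H].
Proof.
move=> [g [h gh hg]]; exists (val \o h); split.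
- by move=> u v /=; rewrite (can2_gmulfM gh hg).
- by apply: inj_comp; [exact: val_inj | exact: can_inj hg].
- apply/seteqP; split=> [_ [u _ <-]|u Hu] /=; first by have /set_mem := valP (h u).
  have uH : u \in subgroup_set H by exact/mem_set.
  by exists (g (exist _ u uH)) => //=; rewrite gh.
Qed.

Section TorsionQuotient.
Variables (Q : groupType) (d : nat) (x : 'I_d -> Q) (m : nat).
Hypotheses (gx : generates x) (m0 : (0 < m)%N).
Hypothesis hm : forall u, lcs Q 1 u -> u ^+ m = 1.

Lemma torsion_subgroup : is_subgroup (torsion Q).
Proof.
have [N [p [pM _ pK pZ]]] := lcs_quotient Q 0.
split=> [|u v [a [a0 ua]] [b [b0 vb]]|u [a [a0 ua]]].
- by exists 1%N.
- exists (a * b * m)%N; split; first by rewrite !muln_gt0 a0 b0.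
  rewrite expgnA; apply: hm; apply/pK.
  rewrite (homX pM) pM expgMn; last exact: pZ.
  rewrite -!(homX pM) -pM expgnA ua expg1n mulnC expgnA vb expg1n mulg1.
  exact: hom1.
- by exists a; rewrite expVgn ua invg1.
Qed.

Lemma torsion_normal : normal_set (torsion Q).
Proof.
by move=> u v [n [n0 un]]; exists n; split=> //; rewrite -conjXg un conj1g.
Qed.

Lemma torsion_quotient : exists (T : subgroup Q) (nT : normal T),
  (T : set Q) = torsion Q /\ free_abelian (quotient nT).
Proof.
pose T := Subgroup torsion_subgroup.
have nT : normal T by move=> u v; apply: torsion_normal.
exists T, nT; split=> //.
have [pM pS pK] := quotient_piE nT; set p := (fun u => _) in pM pS pK.
apply: (@torsion_free_free_abelian _ d (p \o x)).
- move=> K sK Kx y; have [u <-] := pS y.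
  exact: (gx (preim_subgroup pM sK) Kx).
- move=> a b; have [u <-] := pS a; have [v <-] := pS b.
  apply/commg_eq1; rewrite -(homR pM); apply/pK.
  by exists m; split=> //; apply: hm; apply: (lcs_comm (n := 0)).
- move=> a n n0; have [u <-] := pS a; rewrite -(homX pM) => /pK[k [k0 uk]].
  by apply/pK; exists (n * k)%N; rewrite muln_gt0 n0 expgnA.
Qed.

End TorsionQuotient.

Theorem theorem1p1 (G : groupType) (Gam : nat -> subgroup G)
    (fgG : finitely_generated G)
    (Gam0 : Gam 0%N = [set: G] :> set G)
    (Gam_decr : forall k : nat, (Gam k.+1 : set G) `<` (Gam k : set G))
    (Gam_normal : forall k : nat, normal (Gam k))
    (Gam_findex : forall k : nat, finite_index (Gam k))
    (Gam_iso : forall k : nat, isomorphic (subgroup_type (Gam k)) G) :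
  let Q : groupType := quotient (bigcap_normal Gam_normal) in
  nilpotent Q /\
  exists (T : subgroup Q) (nT : normal T),
    (T : set Q) = torsion Q /\ free_abelian (quotient nT).
Proof.
move=> Q.
have [d [x gx]] := finitely_generatedP fgG.
have /boolp.choice[f hf] : forall k, exists f : G -> G,
    [/\ {morph f : x y / x * y}, injective f & range f = Gam k].
  by move=> k; apply: isomorphic_embedding.
have fM k : {morph f k : u v / u * v} by have [] := hf k.
have fI k : injective (f k) by have [] := hf k.
have fR k : range (f k) = Gam k by have [] := hf k.
have /boolp.choice[s hs] : forall k, exists n, index_le setT (Gam k) n.
  by move=> k; apply: finite_index_le.
have nR k : normal_set (range (f k)) by rewrite fR; exact: Gam_normal.
have iR k : index_le setT (range (f k)) (s k) by rewrite fR; exact: hs.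
have dR k : range (f k.+1) `<=` range (f k) by rewrite !fR; case: (Gam_decr k).
have [pM pS pE] := quotient_piE (bigcap_normal Gam_normal).
set p := (fun u => _) in pM pS pE.
have pK u : p u = 1 <-> forall k, range (f k) u.
  by split=> [/pE Ru k|Ru]; [|apply/pE => k _]; have := Ru k; rewrite fR => h; exact: h.
have [nQ [m m0 hm]] := chain_quotient gx fM fI nR iR dR pM pS pK.
split=> //; apply: (@torsion_quotient _ d (p \o x) m) => //.
move=> K sK Kx y; have [u <-] := pS y.
exact: (gx _ (preim_subgroup pM sK) Kx).
Qed.
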